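(* Let $\mathbf{A}\in\mathbb{R}^{n\times d}$ have nonzero rows $a_1,\dots,a_n$, assume $\mathrm{gap}>0$, and let $\lambda$ satisfy $\lambda_1(1+\frac{\mathrm{gap}}{150})\le\lambda\le\lambda_1(1+\frac{\mathrm{gap}}{100})$. Let $\mathbf{B}=\lambda\mathbf{I}-\mathbf{A}^\top\mathbf{A}$, let $c\in\mathbb{R}^d$ and $x^*=\arg\min_{x\in\mathbb{R}^d}\frac12x^\top\mathbf{B}x-c^\top x$. There is a randomized algorithm which, given an initial point $x^0\in\mathbb{R}^d$, returns $x$ with $\mathbb{E}\|x-x^*\|_{\mathbf{B}}^2\le\frac12\|x^0-x^*\|_{\mathbf{B}}^2$ in running time $$O\left(\mathrm{nnz}(\mathbf{A})+\frac{1}{\mathrm{gap}^2\lambda_1}\sum_{i=1}^n\|a_i\|_2^2\left(\sqrt{s_i}+\sqrt{\mathrm{sr}(\mathbf{A})}\right)\sqrt{s_i}\right).$$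
   Context: $\mathrm{nnz}(\mathbf{A})$ is the number of nonzero entries of $\mathbf{A}$; $s_i=\|a_i\|_1^2/\|a_i\|_2^2$; $\mathrm{sr}(\mathbf{A})=\|\mathbf{A}\|_F^2/\|\mathbf{A}\|_2^2$; $\lambda_1\ge\lambda_2$ are the two largest eigenvalues of $\mathbf{A}^\top\mathbf{A}$ and $\mathrm{gap}=(\lambda_1-\lambda_2)/\lambda_1$; $\|y\|_{\mathbf{B}}^2=y^\top\mathbf{B}y$.
   Formalization: The algorithm knows gap as well as A (in sparse form), λ and c; x is returned so that each coordinate is readable in O(1) time, and writing out all d coordinates is not charged (charging it makes the bound false when A has many zero columns). *)

(* Defs.v *)
From HB Require Import structures.
From mathcomp Require Import all_boot all_order all_algebra.
From mathcomp Require Import boolp classical_sets reals.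

Set Implicit Arguments.
Unset Strict Implicit.
Unset Printing Implicit Defensive.

Import Order.TTheory GRing.Theory Num.Theory.
Local Open Scope ring_scope.

Section Norms.
Variable R : realType.

Definition l1norm m (v : 'rV[R]_m) : R := \sum_j `|v 0 j|.
Definition l2norm m (v : 'rV[R]_m) : R := Num.sqrt (\sum_j v 0 j ^+ 2).
Definition frobnorm n d (A : 'M[R]_(n, d)) : R :=
  Num.sqrt (\sum_i \sum_j A i j ^+ 2).

(* Operator norm of A acting on column vectors; the set is nonempty (x = 0)
   and bounded above, so that [sup] is its least upper bound. *)
Definition specnorm n d (A : 'M[R]_(n, d)) : R :=
  sup [set l2norm (A *m x)^T | x in [set x : 'cV[R]_d | l2norm x^T <= 1]].

Definition nnz n d (A : 'M[R]_(n, d)) : nat :=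
  #|[set ij : 'I_n * 'I_d | A ij.1 ij.2 != 0]|.

Definition numsparsity n d (A : 'M[R]_(n, d)) (i : 'I_n) : R :=
  l1norm (row i A) ^+ 2 / l2norm (row i A) ^+ 2.

Definition stable_rank n d (A : 'M[R]_(n, d)) : R :=
  frobnorm A ^+ 2 / specnorm A ^+ 2.

(* [s] lists all eigenvalues of [M], with multiplicity, largest first. *)
Definition eigenvalues_desc m (M : 'M[R]_m) (s : seq R) : Prop :=
  char_poly M = \prod_(l <- s) ('X - l%:P) /\ sorted >=%R s.

Definition sqnorm m (B : 'M[R]_m) (y : 'cV[R]_m) : R := (y^T *m B *m y) 0 0.

Definition quad_obj m (B : 'M[R]_m) (c x : 'cV[R]_m) : R :=
  2^-1 * (x^T *m B *m x) 0 0 - (c^T *m x) 0 0.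

Definition is_argmin T (f : T -> R) (x : T) : Prop := forall y, f x <= f y.

End Norms.

(* A randomized real RAM, as a small imperative language.  Memory consists of
   integer-valued and real-valued arrays; a cell is addressed by an array name,
   fixed in the program text, and two computed indices.  A program is a finite
   piece of syntax independent of the input and of the field of reals.  There
   is no conversion from reals to integers and no integer multiplication;
   information about a real number is obtained only by comparisons and biased
   coin flips. *)
Inductive nexpr : Type :=
  | NConst of nat
  | NLoad of nat & nexpr & nexpr
  | NAdd of nexpr & nexpr
  | NSub of nexpr & nexpr.

Inductive rexpr : Type :=
  | RNat of nexpr
  | RLoad of nat & nexpr & nexpr
  | RAdd of rexpr & rexpr
  | RSub of rexpr & rexpr
  | RMul of rexpr & rexpr
  | RDiv of rexpr & rexpr
  | RSqrt of rexpr.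

Inductive bexpr : Type :=
  | BNLt of nexpr & nexpr
  | BRLt of rexpr & rexpr
  | BNot of bexpr
  | BAnd of bexpr & bexpr.

Inductive cmd : Type :=
  | NStore of nat & nexpr & nexpr & nexpr
  | RStore of nat & nexpr & nexpr & rexpr
  | Flip of nat & nexpr & nexpr & rexpr
  | Unif of nat & nexpr & nexpr & nexpr
  | Seq of cmd & cmd
  | If of bexpr & cmd & cmd
  | While of bexpr & cmd.

Record program : Type := Program { body : cmd; out : rexpr }.

Section Semantics.
Variable R : rcfType.

Record state : Type := State {
  nmem : nat -> nat -> nat -> nat;
  rmem : nat -> nat -> nat -> R }.

Definition upd V (m : nat -> nat -> nat -> V) (a i k : nat) (v : V) :=
  fun a' i' k' => if [&& a' == a, i' == i & k' == k] then v else m a' i' k'.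

Definition nset (s : state) (a i k v : nat) : state :=
  State (upd (nmem s) a i k v) (rmem s).

Definition rset (s : state) (a i k : nat) (v : R) : state :=
  State (nmem s) (upd (rmem s) a i k v).

Fixpoint neval (s : state) (e : nexpr) : nat :=
  match e with
  | NConst m => m
  | NLoad a i k => nmem s a (neval s i) (neval s k)
  | NAdd e1 e2 => (neval s e1 + neval s e2)%N
  | NSub e1 e2 => (neval s e1 - neval s e2)%N
  end.

Fixpoint reval (s : state) (e : rexpr) : R :=
  match e with
  | RNat m => (neval s m)%:R
  | RLoad a i k => rmem s a (neval s i) (neval s k)
  | RAdd e1 e2 => reval s e1 + reval s e2
  | RSub e1 e2 => reval s e1 - reval s e2
  | RMul e1 e2 => reval s e1 * reval s e2
  | RDiv e1 e2 => reval s e1 / reval s e2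
  | RSqrt e1 => Num.sqrt (reval s e1)
  end.

Fixpoint beval (s : state) (b : bexpr) : bool :=
  match b with
  | BNLt e1 e2 => (neval s e1 < neval s e2)%N
  | BRLt e1 e2 => reval s e1 < reval s e2
  | BNot b1 => ~~ beval s b1
  | BAnd b1 b2 => beval s b1 && beval s b2
  end.

(* What remains to be executed, together with the memory. *)
Definition config : Type := (seq cmd * state)%type.

(* Distribution of the next configuration, as a list of pairs
   (probability, configuration).  [Flip] stores 1 with the given probability
   (truncated to [0, 1]) and 0 otherwise; [Unif] stores a uniform element of
   {0, ..., m}.  The expressions evaluated in one step are part of the program
   text, so one step is a number of elementary operations bounded in terms of
   the program only. *)
Definition step (cf : config) : seq (R * config) :=
  let s := cf.2 in
  match cf.1 with
  | [::] => [:: (1, cf)]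
  | c :: k =>
    match c with
    | NStore a i j e =>
        [:: (1, (k, nset s a (neval s i) (neval s j) (neval s e)))]
    | RStore a i j e =>
        [:: (1, (k, rset s a (neval s i) (neval s j) (reval s e)))]
    | Flip a i j e =>
        let p := Num.min 1 (Num.max 0 (reval s e)) in
        [:: (p, (k, nset s a (neval s i) (neval s j) 1));
            (1 - p, (k, nset s a (neval s i) (neval s j) 0))]
    | Unif a i j e =>
        let m := neval s e in
        [seq (m.+1%:R^-1, (k, nset s a (neval s i) (neval s j) v))
           | v <- iota 0 m.+1]
    | Seq c1 c2 => [:: (1, ([:: c1, c2 & k], s))]
    | If b c1 c2 => [:: (1, ((if beval s b then c1 else c2) :: k, s))]
    | While b c1 =>
        [:: (1, (if beval s b then [:: c1, c & k] else k, s))]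
    end
  end.

Fixpoint run (t : nat) (cf : config) : seq (R * config) :=
  if t is t'.+1 then
    [seq (o.1 * o'.1, o'.2) | o <- step cf, o' <- run t' o.2]
  else [:: (1, cf)].

Definition start (P : program) (s : state) : config := ([:: body P], s).

(* Every execution path terminates after at most [t] steps. *)
Definition halts_within (P : program) (s : state) (t : nat) : bool :=
  all (fun o => nilp o.2.1) (run t (start P s)).

(* The returned vector: its [j]-th entry is the value of the fixed expression
   [out P] in the final memory once [j] has been put into the cell (3, 0, 0)
   of the integer memory; it can be read off in constant time.  The usual
   "the answer is in array a" is the case
   [out P = RLoad a (NLoad 3 (NConst 0) (NConst 0)) (NConst 0)]. *)
Definition output (P : program) (d : nat) (s : state) : 'cV[R]_d :=
  \col_(j < d) reval (nset s 3 0 0 j) (out P).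

(* Expectation of [f] applied to the vector returned after [t] steps. *)
Definition expected_output (P : program) (d : nat) (s : state) (t : nat)
    (f : 'cV[R]_d -> R) : R :=
  \sum_(o <- run t (start P s)) o.1 * f (output P d o.2.2).

Definition row_support n d (A : 'M[R]_(n, d)) (i : 'I_n) : seq 'I_d :=
  [seq j <- enum 'I_d | A i j != 0].

Definition entry m (v : 'cV[R]_m) (j : nat) : R :=
  if insub j is Some j' then v j' 0 else 0.

(* Sparse row format.  Integer arrays: 0 holds n and d; 1 holds at i the number
   of nonzero entries of row i; 2 holds at (i, k) the column of the k-th
   nonzero entry of row i.  Real arrays: 0 holds lam and g; 1 holds at (i, k)
   the value of the k-th nonzero entry of row i; 2 holds c; 3 holds x0.  All
   other cells are 0. *)
Definition input n d (A : 'M[R]_(n, d)) (lam g : R) (c x0 : 'cV[R]_d) : state :=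
  State
    (fun a i k => match a, i, k with
     | 0, 0, 0 => n
     | 0, 0, 1 => d
     | 1, _, 0 => if insub i is Some i' then size (row_support A i') else 0
     | 2, _, _ => if insub i is Some i'
                  then nth 0%N [seq val j | j <- row_support A i'] k else 0
     | _, _, _ => 0
     end%N)
    (fun a i k => match a, i, k with
     | 0%N, 0%N, 0%N => lam
     | 0%N, 0%N, 1%N => g
     | 1%N, _, _ => if insub i is Some i'
                    then nth 0 [seq A i' j | j <- row_support A i'] k else 0
     | 2%N, _, 0%N => entry c i
     | 3%N, _, 0%N => entry x0 i
     | _, _, _ => 0
     end).

End Semantics.

(* Main.v *)
Require Import Defs.
From HB Require Import structures.
From mathcomp Require Import all_boot all_order all_algebra.
From mathcomp Require Import boolp classical_sets reals.
From mathcomp Require Import ring lra zify.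

Set Implicit Arguments.
Unset Strict Implicit.
Unset Printing Implicit Defensive.

Import Order.TTheory GRing.Theory Num.Theory.
Local Open Scope ring_scope.

(** The algorithm is one epoch of variance-reduced stochastic gradient descent on
    [f x = x^T B x / 2 - c^T x], started at [x0].  The gradient at
    [x = x0 + v] is [B x0 - c + lam v - A^T A v]: the first part is computed once
    in time nnz(A), and A^T A v is estimated by sampling a row a_i with
    probability proportional to its squared norm, then [rho_i] coordinates of a_i
    (drawn with probability about |a_ij| / |a_i|_1) to estimate <a_i, v>, and as
    many to estimate a_i.  With [rho_i = sqrt s_i (sqrt s_i + sqrt (F / lam))] and
    [F = |A|_F^2] the second moment of the estimate is at most [18 F lam |v|^2];
    a step of size [eta ~ gap / F] then decreases the expectation of
    [|x - x*|^2] by [eta |x - x*|_B^2] up to [eta / 8 |x0 - x*|_B^2].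

    The iterate is kept as [x0 + beta (B x0 - c) + sigma w], so that a step touches
    only the sampled coordinates.  Sampling takes constant time: an
    entry of weight [p] among [m] is repeated [ceil (m p)] times in a table with
    at most [2 m] slots.  With [m] iterations left, the algorithm stops with
    probability [1 / m]; this returns a uniformly random iterate, which controls
    the B-norm although the descent is in the Euclidean norm.  To get a worst-case
    running time, the algorithm gives up and returns [x0] as soon as the number of
    samples exceeds four times its expected value.  All three
    effects are accounted for by the single potential [potential] of [main_loop],
    evaluated backwards along the execution. *)

(** * Rules for running time and expectation *)

Section Rules.
Variable R : realType.
Variable phi : state R -> R.
Implicit Types (s : state R) (cf : config R) (k : seq cmd) (c : cmd).

Definition halted t cf := all (fun o => nilp o.2.1) (run t cf).
Definition expectation t cf := \sum_(o <- run t cf) o.1 * phi o.2.2.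

Lemma haltedS t cf : halted t.+1 cf = all (fun o => halted t o.2) (step cf).
Proof.
rewrite /halted /=; elim: (step cf) => //= o l <-.
by rewrite all_cat all_map; congr (_ && _); apply: eq_all.
Qed.

Lemma expectationS t cf :
  expectation t.+1 cf = \sum_(o <- step cf) o.1 * expectation t o.2.
Proof.
rewrite /expectation /= big_allpairs_dep /=; apply: eq_bigr => o _.
by rewrite mulr_sumr; apply: eq_bigr => o' _ /=; rewrite mulrA.
Qed.

Lemma halted_nil t s : halted t ([::], s).
Proof. by elim: t => // t IH; rewrite haltedS /= IH. Qed.

Lemma expectation_nil t s : expectation t ([::], s) = phi s.
Proof.
elim: t => [|t IH]; first by rewrite /expectation /= big_seq1 mul1r.
by rewrite expectationS /= big_seq1 IH mul1r.
Qed.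

(** An empty continuation steps to itself with probability 1, so extra steps are harmless. This lets
    branches that stop at different times be compared at a common time. *)
Lemma halted_le t t' cf : (t <= t')%N -> halted t cf ->
  halted t' cf /\ expectation t' cf = expectation t cf.
Proof.
elim: t t' cf => [|t IH] t' cf.
  rewrite {1}/halted /= andbT => _; case: cf => k s /nilP /= ->.
  by rewrite halted_nil !expectation_nil.
case: t' => // t' le_tt'; rewrite !haltedS !expectationS.
elim: (step cf) => [|o l IHl] /=; first by rewrite !big_nil.
rewrite !big_cons => /andP[ho /IHl[hl ->]].
by have [-> ->] := IH _ _ le_tt' ho; rewrite hl.
Qed.

(** The judgement of all later bounds: [tau] limits the worst-case time and [v] the final
    expectation of [phi]. Both are real, so that time budgets need not be rounded, and [v] is
    computed backwards from the end of the execution. *)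
Definition ok (tau : R) k s (v : R) :=
  exists t : nat, [/\ t%:R <= tau, halted t (k, s) & expectation t (k, s) <= v].

Lemma ok_weaken tau tau' k s v v' :
  ok tau k s v -> tau <= tau' -> v <= v' -> ok tau' k s v'.
Proof.
move=> [t [ht hh he]] hle hv; exists t; split=> //.
  exact: le_trans ht hle.
exact: le_trans he hv.
Qed.

Lemma ok_nil s tau v : 0 <= tau -> phi s <= v -> ok tau [::] s v.
Proof. by move=> h0 hv; exists 0%N; rewrite halted_nil expectation_nil. Qed.

(** Time is a worst case and takes the maximum over the branches, while values are averaged. *)
Lemma ok_branch (I : eqType) (r : seq I) (p : I -> R) (f : I -> config R)
    (w : I -> R) c k s tau :
  step (c :: k, s) = [seq (p i, f i) | i <- r] ->
  (forall i, i \in r -> 0 <= p i) -> 0 <= tau ->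
  (forall i, i \in r -> ok tau (f i).1 (f i).2 (w i)) ->
  ok (tau + 1) (c :: k) s (\sum_(i <- r) p i * w i).
Proof.
move=> Es p_ge0 tau_ge0 hok.
suff [t ht [hh he]] : exists2 t : nat, t%:R <= tau &
    all (fun i => halted t (f i)) r /\
    \sum_(i <- r) p i * expectation t (f i) <= \sum_(i <- r) p i * w i.
  exists t.+1; split; first by rewrite -natr1 lerD2r.
    by rewrite haltedS Es all_map.
  by rewrite expectationS Es big_map.
elim: r p_ge0 hok {Es} => [|i r IH] p_ge0 hok.
  by exists 0%N => //; rewrite !big_nil.
have [||t ht [hh he]] := IH; [| |].
- by move=> j jr; apply: p_ge0; rewrite inE jr orbT.
- by move=> j jr; apply: hok; rewrite inE jr orbT.
have [t' [ht' hh' he']] := hok i (mem_head _ _).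
move: hh' he'; rewrite -surjective_pairing => hh' he'.
exists (maxn t t'); first by rewrite natr_max ge_max ht ht'.
have mono j : halted t (f j) -> halted (maxn t t') (f j) /\
    expectation (maxn t t') (f j) = expectation t (f j).
  by apply: halted_le; rewrite leq_maxl.
have [h1 h2] := halted_le (leq_maxr t t') hh'.
rewrite !big_cons /= h1 h2; split.
  by apply: sub_all hh => j /mono[].
apply: lerD; first by rewrite ler_wpM2l // p_ge0 ?mem_head.
apply: le_trans he; rewrite le_eqVlt; apply/orP; left; apply/eqP.
apply: eq_big_seq => j jr; congr (_ * _).
by move/allP: hh => /(_ j jr) /mono[].
Qed.

Lemma ok_det tau c k s k' s' v : step (c :: k, s) = [:: (1, (k', s'))] ->
  ok tau k' s' v -> ok (tau + 1) (c :: k) s v.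
Proof.
move=> Es hok; have tau0 : 0 <= tau.
  by case: hok => t [ht _ _]; apply: le_trans ht; rewrite ler0n.
have -> : v = \sum_(i <- [:: tt]) (1 : R) * v by rewrite big_seq1 mul1r.
by apply: (@ok_branch unit [:: tt] _ (fun=> (k', s'))) => // i _; rewrite ler01.
Qed.

Lemma ok_ge0 tau k s v : ok tau k s v -> 0 <= tau.
Proof. by case=> t [ht _ _]; apply: le_trans ht; rewrite ler0n. Qed.

Lemma ok_nstore tau a i j e k s v :
  ok tau k (nset s a (neval s i) (neval s j) (neval s e)) v ->
  ok (tau + 1) (NStore a i j e :: k) s v.
Proof. exact: ok_det. Qed.

Lemma ok_rstore tau a i j e k s v :
  ok tau k (rset s a (neval s i) (neval s j) (reval s e)) v ->
  ok (tau + 1) (RStore a i j e :: k) s v.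
Proof. exact: ok_det. Qed.

Lemma ok_seq tau c1 c2 k s v :
  ok tau [:: c1, c2 & k] s v -> ok (tau + 1) (Seq c1 c2 :: k) s v.
Proof. exact: ok_det. Qed.

Lemma ok_if tau b c1 c2 k s v :
  ok tau ((if beval s b then c1 else c2) :: k) s v ->
  ok (tau + 1) (If b c1 c2 :: k) s v.
Proof. exact: ok_det. Qed.

Lemma ok_while tau b c k s v :
  ok tau (if beval s b then [:: c, While b c & k] else k) s v ->
  ok (tau + 1) (While b c :: k) s v.
Proof. exact: ok_det. Qed.

Lemma ok_unif tau a i j e k s (w : nat -> R) : 0 <= tau ->
  (forall x, (x <= neval s e)%N ->
     ok tau k (nset s a (neval s i) (neval s j) x) (w x)) ->
  ok (tau + 1) (Unif a i j e :: k) s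
    ((neval s e).+1%:R^-1 * \sum_(x < (neval s e).+1) w x).
Proof.
move=> tau0 hok.
rewrite mulr_sumr -(big_mkord predT (fun x => (neval s e).+1%:R^-1 * w x)).
rewrite /index_iota subn0.
apply: (@ok_branch _ _ (fun=> (neval s e).+1%:R^-1)
  (fun x => (k, nset s a (neval s i) (neval s j) x))) => //.
  by move=> x _; rewrite invr_ge0.
by move=> x; rewrite mem_iota ltnS /=; exact: hok.
Qed.

Lemma ok_flip tau a i j e k s (w1 w0 : R) :
  0 <= reval s e <= 1 ->
  ok tau k (nset s a (neval s i) (neval s j) 1) w1 ->
  ok tau k (nset s a (neval s i) (neval s j) 0) w0 ->
  ok (tau + 1) (Flip a i j e :: k) s (reval s e * w1 + (1 - reval s e) * w0).
Proof.
move=> /andP[p0 p1] h1 h0; set p := reval s e in p0 p1 *.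
have -> : p * w1 + (1 - p) * w0 = \sum_(b <- [:: true; false])
   (if b then p else 1 - p) * (if b then w1 else w0).
  by rewrite big_cons big_seq1.
apply: (@ok_branch _ _ _ (fun b : bool =>
  (k, nset s a (neval s i) (neval s j) (if b then 1 else 0)%N))).
- have step_flip : step (Flip a i j e :: k, s) =
    [:: (Num.min 1 (Num.max 0 p), (k, nset s a (neval s i) (neval s j) 1));
        (1 - Num.min 1 (Num.max 0 p),
         (k, nset s a (neval s i) (neval s j) 0))] by [].
  by rewrite step_flip (max_r p0) (min_r p1).
- by case=> _ //; rewrite subr_ge0.
- exact: ok_ge0 h1.
- by case.
Qed.

(** A Hoare triple in continuation form: the value [v] promised by what follows is passed through
    unchanged. This suits the preprocessing, which draws no random numbers. *)
Definition spec (P : state R -> Prop) c (b : R) (Q : state R -> Prop) :=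
  forall s k tau v, P s -> (forall s', Q s' -> ok tau k s' v) ->
    ok (tau + b) (c :: k) s v.

Lemma spec_weaken (P P' Q Q' : state R -> Prop) c b b' :
  (forall s, P' s -> P s) -> (forall s, Q s -> Q' s) -> b <= b' ->
  spec P c b Q -> spec P' c b' Q'.
Proof.
move=> hP hQ hb sp s k tau v /hP Ps hk.
apply: (@ok_weaken (tau + b) _ _ _ v) => //; last by rewrite lerD2l.
by apply: (sp _ _ _ _ Ps) => s' /hQ; exact: hk.
Qed.

Lemma spec_nstore (P Q : state R -> Prop) a i j e :
  (forall s, P s -> Q (nset s a (neval s i) (neval s j) (neval s e))) ->
  spec P (NStore a i j e) 1 Q.
Proof. by move=> h s k tau v Ps hk; apply: ok_nstore; apply: hk; apply: h. Qed.

Lemma spec_rstore (P Q : state R -> Prop) a i j e :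
  (forall s, P s -> Q (rset s a (neval s i) (neval s j) (reval s e))) ->
  spec P (RStore a i j e) 1 Q.
Proof. by move=> h s k tau v Ps hk; apply: ok_rstore; apply: hk; apply: h. Qed.

Lemma spec_seq (P Q S : state R -> Prop) c1 c2 b1 b2 :
  spec P c1 b1 Q -> spec Q c2 b2 S -> spec P (Seq c1 c2) (b1 + b2 + 1) S.
Proof.
move=> h1 h2 s k tau v Ps hk; rewrite addrA; apply: ok_seq.
apply: (@ok_weaken (tau + b2 + b1) _ _ _ v) => //; last by lra.
by apply: (h1 _ _ _ _ Ps) => s' Qs'; apply: (h2 _ _ _ _ Qs').
Qed.

(** For loops whose number of iterations is known in advance; each guard test costs one step,
    including the last one that fails. *)
Lemma spec_while N (I : nat -> state R -> Prop) (b : nat -> R) g c :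
  (forall i s, (i <= N)%N -> I i s -> beval s g = (i < N)%N) ->
  (forall i, (i < N)%N -> spec (I i) c (b i) (I i.+1)) ->
  spec (I 0%N) (While g c) (\sum_(i < N) (b i + 1) + 1) (I N).
Proof.
move=> hg hc s k tau v I0 hk.
suff H m : forall i s, (i + m)%N = N -> I i s ->
    ok (tau + (\sum_(j < m) (b (i + j)%N + 1) + 1)) (While g c :: k) s v.
  by apply: H I0; rewrite add0n.
elim: m => [|m IH] i s' Ei Is.
  rewrite big_ord0 add0r; apply: ok_while.
  by rewrite (hg i) -?Ei ?addn0 // ltnn; apply: hk; rewrite -Ei addn0.
have lt_iN : (i < N)%N by lia.
rewrite addrA; apply: ok_while; rewrite (hg i) ?lt_iN 1?ltnW //.
rewrite big_ord_recl addn0 /=.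
apply: (@ok_weaken (tau + (\sum_(j < m) (b (i.+1 + j)%N + 1) + 1) + b i)
   _ _ _ v) => //; last first.
  have -> : \sum_(j < m) (b (i.+1 + j)%N + 1) = \sum_(j < m) (b (i + bump 0 j)%N + 1).
    by apply: eq_bigr => j _; rewrite addSnnS.
  lra.
by apply: (hc i lt_iN _ _ _ _ Is) => s'' Is''; apply: IH => //; lia.
Qed.

End Rules.

(** * Spectral bounds *)

Section Dot.
Variable R : realType.

Definition dotp m (u v : 'cV[R]_m) : R := (u^T *m v) 0 0.

Lemma dotpE m (u v : 'cV[R]_m) : dotp u v = \sum_j u j 0 * v j 0.
Proof. by rewrite /dotp mxE; apply: eq_bigr => j _; rewrite mxE. Qed.

Lemma dotpC m (u v : 'cV[R]_m) : dotp u v = dotp v u.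
Proof. by rewrite !dotpE; apply: eq_bigr => j _; rewrite mulrC. Qed.

Lemma dotpDr m (u v w : 'cV[R]_m) : dotp u (v + w) = dotp u v + dotp u w.
Proof. by rewrite /dotp mulmxDr mxE. Qed.

Lemma dotpZr m a (u v : 'cV[R]_m) : dotp u (a *: v) = a * dotp u v.
Proof. by rewrite /dotp -scalemxAr mxE. Qed.

Lemma dotpNr m (u v : 'cV[R]_m) : dotp u (- v) = - dotp u v.
Proof. by rewrite /dotp mulmxN mxE. Qed.

Lemma dotpDl m (u v w : 'cV[R]_m) : dotp (v + w) u = dotp v u + dotp w u.
Proof. by rewrite dotpC dotpDr !(dotpC u). Qed.

Lemma dotpZl m a (u v : 'cV[R]_m) : dotp (a *: v) u = a * dotp v u.
Proof. by rewrite dotpC dotpZr (dotpC u). Qed.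

Lemma dotpNl m (u v : 'cV[R]_m) : dotp (- v) u = - dotp v u.
Proof. by rewrite dotpC dotpNr (dotpC u). Qed.

Lemma dotp0l m (u : 'cV[R]_m) : dotp 0 u = 0.
Proof. by rewrite /dotp trmx0 mul0mx mxE. Qed.

Lemma dotp_sumr m (I : finType) (u : 'cV[R]_m) (f : I -> 'cV[R]_m) :
  dotp u (\sum_i f i) = \sum_i dotp u (f i).
Proof. by rewrite /dotp mulmx_sumr summxE. Qed.

Lemma dotp_adj m n (A : 'M[R]_(m, n)) u v : dotp u (A^T *m v) = dotp (A *m u) v.
Proof. by rewrite /dotp trmx_mul mulmxA. Qed.

Lemma dotp_ge0 m (u : 'cV[R]_m) : 0 <= dotp u u.
Proof. by rewrite dotpE; apply: sumr_ge0 => j _; rewrite -expr2 sqr_ge0. Qed.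

Lemma dotp_eq0 m (u : 'cV[R]_m) : dotp u u = 0 -> u = 0.
Proof.
rewrite dotpE => /eqP; rewrite psumr_eq0 => [/allP H|j _]; last first.
  by rewrite -expr2 sqr_ge0.
apply/matrixP => i j; rewrite ord1 mxE; apply/eqP.
by have := H i (mem_index_enum _); rewrite mulf_eq0 orbb.
Qed.

Lemma dotp_gt0 m (u : 'cV[R]_m) : u != 0 -> 0 < dotp u u.
Proof.
by move=> u0; rewrite lt_neqAle dotp_ge0 eq_sym andbT;
  apply: contra_neq u0; apply: dotp_eq0.
Qed.

Lemma dotp_mulmx_delta m n (A : 'M[R]_(m, n)) j :
  dotp (A *m delta_mx j 0) (A *m delta_mx j 0) = \sum_i A i j ^+ 2.
Proof. by rewrite -colE dotpE; apply: eq_bigr => i _; rewrite !mxE expr2. Qed.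

(** A quadratic polynomial without sign change has nonpositive discriminant; evaluate it at its
    minimum [- b / c]. *)
Lemma discr_le (a b c : R) : 0 <= c ->
  (forall t, 0 <= a + 2 * t * b + t ^+ 2 * c) -> b ^+ 2 <= a * c.
Proof.
move=> c0 H; have [c00|cn0] := eqVneq c 0.
  have [->|bn0] := eqVneq b 0; first by rewrite c00 mulr0 expr0n.
  (* In the linear case this point gives the value -1. *)
  have := H (- (a + 1) / (2 * b)); rewrite c00 mulr0 addr0.
  have -> : 2 * (- (a + 1) / (2 * b)) * b = - (a + 1) by field.
  lra.
have cp : 0 < c by rewrite lt_neqAle eq_sym cn0.
have := H (- b / c).
have -> : a + 2 * (- b / c) * b + (- b / c) ^+ 2 * c = (a * c - b ^+ 2) / c by field.
by rewrite pmulr_lge0 ?invr_gt0 // subr_ge0.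
Qed.

Lemma psd_cauchy m (N : 'M[R]_m) (x y : 'cV[R]_m) : N^T = N ->
  (forall z, 0 <= dotp z (N *m z)) ->
  dotp x (N *m y) ^+ 2 <= dotp x (N *m x) * dotp y (N *m y).
Proof.
move=> symN psd; apply: discr_le => // t.
have := psd (x + t *: y).
rewrite mulmxDr !dotpDr !dotpDl -!scalemxAr !dotpZr !dotpZl.
have -> : dotp y (N *m x) = dotp x (N *m y).
  by rewrite -{1}symN dotp_adj dotpC.
by congr (0 <= _); ring.
Qed.

Lemma cauchy_schwarz m (x y : 'cV[R]_m) :
  dotp x y ^+ 2 <= dotp x x * dotp y y.
Proof.
have := @psd_cauchy m 1%:M x y; rewrite trmx1 !mul1mx; apply => // z.
by rewrite mul1mx dotp_ge0.
Qed.

Lemma frob_bound m n (A : 'M[R]_(m, n)) x :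
  dotp (A *m x) (A *m x) <= (\sum_i \sum_j A i j ^+ 2) * dotp x x.
Proof.
rewrite dotpE mulr_suml; apply: ler_sum => i _.
have -> : (A *m x) i 0 = dotp (row i A)^T x.
  by rewrite dotpE mxE; apply: eq_bigr => j _; rewrite !mxE.
rewrite -expr2; apply: le_trans (cauchy_schwarz _ _) _.
rewrite le_eqVlt; apply/orP; left; apply/eqP; congr (_ * _).
by rewrite dotpE; apply: eq_bigr => j _; rewrite !mxE expr2.
Qed.

Lemma sqr_sqrt_sum (I : finType) (f : I -> R) :
  Num.sqrt (\sum_i f i ^+ 2) ^+ 2 = \sum_i f i ^+ 2.
Proof. by rewrite sqr_sqrtr // sumr_ge0 // => i _; rewrite sqr_ge0. Qed.

End Dot.

(** * Eigenvalues of the Gram matrix and the operator norm *)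

Section Spectral.
Variables (R : realType) (n d : nat) (A : 'M[R]_(n, d)).
Let H := A^T *m A.

Lemma dotp_gram x : dotp x (H *m x) = dotp (A *m x) (A *m x).
Proof. by rewrite /H -mulmxA dotp_adj. Qed.

Lemma gram_sym : H^T = H.
Proof. by rewrite /H trmx_mul trmxK. Qed.

Lemma gram_eigen a : root (char_poly H) a ->
  exists2 v : 'cV[R]_d, 0 < dotp v v & dotp (A *m v) (A *m v) = a * dotp v v.
Proof.
rewrite -eigenvalue_root_char => /eigenvalueP[v Ev v0].
exists v^T; first by apply: dotp_gt0; rewrite trmx_eq0.
rewrite -dotp_gram -{1}gram_sym -trmx_mul Ev linearZ /=.
by rewrite dotpZr.
Qed.

(* At the supremum t of the Rayleigh quotient, N = t - H is positive
   semidefinite; if N were invertible, Cauchy-Schwarz for N applied to x and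
   N^-1 x would bound the quotient away from t.  So t is an eigenvalue. *)
Lemma rayleigh_sup_root : (0 < d)%N -> exists2 t, root (char_poly H) t &
  forall x, dotp (A *m x) (A *m x) <= t * dotp x x.
Proof.
move=> d_gt0.
pose E : set R := [set dotp (A *m x) (A *m x) | x in [set x | dotp x x = 1]]%classic.
have Enon : nonempty E.
  pose j : 'I_d := Ordinal d_gt0.
  exists (dotp (A *m delta_mx j 0) (A *m delta_mx j 0)), (delta_mx j 0) => //=.
  rewrite dotpE (bigD1 j) //= big1 ?addr0; first by rewrite mxE !eqxx mulr1.
  by move=> i /negbTE ij; rewrite mxE ij /= mulr0.
have Eub : ubound E (\sum_i \sum_j A i j ^+ 2).
  by move=> _ [x /= x1 <-]; apply: le_trans (frob_bound _ _) _; rewrite x1 mulr1.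
pose t := sup E.
have ht x : dotp (A *m x) (A *m x) <= t * dotp x x.
  have [->|x0] := eqVneq x 0.
    by rewrite mulmx0 !dotp0l mulr0.
  have xp := dotp_gt0 x0.
  set a := Num.sqrt (dotp x x).
  have ap : 0 < a by rewrite sqrtr_gt0.
  have a2 : a ^+ 2 = dotp x x by rewrite sqr_sqrtr // ltW.
  have : E (dotp (A *m (a^-1 *: x)) (A *m (a^-1 *: x))).
    exists (a^-1 *: x) => //=; rewrite dotpZl dotpZr -a2; field.
    by rewrite gt_eqF.
  move/(ub_le_sup (ex_intro _ _ Eub)); rewrite -/t -scalemxAr dotpZl dotpZr mulrA.
  by rewrite -invfM -expr2 a2 mulrC ler_pdivrMr.
exists t => //; apply/negPn/negP => nroot.
pose N := t%:M - H.
have Nunit : N \in unitmx.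
  rewrite -row_free_unit -kermx_eq0; apply: contraNT nroot => hker.
  by rewrite -eigenvalue_root_char /eigenvalue /eigenspace -oppr_eq0 //
     -[H - _]opprB -/N; move: hker; rewrite oppr_eq0 // !kermx_eq0
     /row_free mxrank_opp.
have Nsym : N^T = N by rewrite /N linearB /= tr_scalar_mx gram_sym.
have NE x : dotp x (N *m x) = t * dotp x x - dotp (A *m x) (A *m x).
  by rewrite /N mulmxBl mul_scalar_mx dotpDr dotpNr dotpZr dotp_gram.
have Npsd x : 0 <= dotp x (N *m x) by rewrite NE subr_ge0.
(* With F the squared Frobenius norm of the inverse, F + 1 dominates its square root, hence the norm
   of the inverse, and is positive. *)
pose K := (\sum_i \sum_j invmx N i j ^+ 2) + 1.
have Kp : 0 < K.
  rewrite /K ltr_pwDr // sumr_ge0 // => i _; rewrite sumr_ge0 // => j _.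
  by rewrite sqr_ge0.
have hK x : dotp x (invmx N *m x) <= K * dotp x x.
  have h1 := cauchy_schwarz x (invmx N *m x).
  have h2 := frob_bound (invmx N) x.
  have h3 := dotp_ge0 x.
  move: h1 h2; rewrite /K; set a := dotp x _; set b := dotp (invmx N *m x) _.
  set F := \sum_i _; move=> h1 h2.
  have F0 : 0 <= F.
    by rewrite sumr_ge0 // => i _; rewrite sumr_ge0 // => j _; rewrite sqr_ge0.
  have h4 : a ^+ 2 <= ((F + 1) * dotp x x) ^+ 2.
    apply: le_trans h1 _; apply: (@le_trans _ _ (dotp x x * (F * dotp x x))).
      by rewrite ler_wpM2l.
    have -> : ((F + 1) * dotp x x) ^+ 2 = dotp x x * (F * dotp x x) +
        (F ^+ 2 + F + 1) * dotp x x ^+ 2 by ring.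
    by rewrite lerDl mulr_ge0 ?sqr_ge0 // !addr_ge0 ?sqr_ge0.
  rewrite leNgt; apply/negP => hlt; move: h4; rewrite leNgt => /negP; apply.
  by rewrite ltr_pXn2r ?nnegrE // ?(ltW (le_lt_trans _ hlt)) ?mulr_ge0 ?addr_ge0.
(* For a unit vector x, Cauchy-Schwarz reads 1 <= (t - |A x|^2) K. *)
have hub : ubound E (t - K^-1).
  move=> _ [x /= x1 <-].
  have := psd_cauchy x (invmx N *m x) Nsym Npsd.
  rewrite mulmxA mulmxV // mul1mx x1 expr1n (dotpC (invmx N *m x)) NE x1 mulr1.
  move=> h; have h2 := hK x; rewrite x1 mulr1 in h2.
  have h3 : 0 <= t - dotp (A *m x) (A *m x).
    by have := ht x; rewrite x1 mulr1 subr_ge0.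
  have : 1 <= (t - dotp (A *m x) (A *m x)) * K.
    by apply: le_trans h _; rewrite ler_wpM2l.
  by rewrite -ler_pdivrMr // div1r; lra.
have := ge_sup Enon hub; rewrite -/t.
have : 0 < K^-1 by rewrite invr_gt0.
lra.
Qed.

Section Eigenvalues.
Variables (lam1 lam2 : R) (lams : seq R).
Hypothesis eigs : eigenvalues_desc H [:: lam1, lam2 & lams].

Lemma eigs_root a : root (char_poly H) a = (a \in [:: lam1, lam2 & lams]).
Proof. by rewrite eigs.1 root_prod_XsubC. Qed.

Lemma eigs_dim : (0 < d)%N.
Proof.
have := size_char_poly H; rewrite eigs.1 size_prod_XsubC /= => [[<-]].
by [].
Qed.

Lemma eigs_ge0 a : a \in [:: lam1, lam2 & lams] -> 0 <= a.
Proof.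
rewrite -eigs_root => /gram_eigen[v v0 Ev].
by have := dotp_ge0 (A *m v); rewrite Ev pmulr_lge0.
Qed.

(** The supremum of the Rayleigh quotient is an eigenvalue, hence at most the head of the sorted
    list. *)
Lemma gram_le_lam1 x : dotp (A *m x) (A *m x) <= lam1 * dotp x x.
Proof.
have [t rt ht] := rayleigh_sup_root eigs_dim.
apply: le_trans (ht x) _; rewrite ler_wpM2r ?dotp_ge0 //.
move: rt; rewrite eigs_root inE => /orP[/eqP->//|].
have hs : path >=%R lam1 (lam2 :: lams) := eigs.2.
by move/(allP (order_path_min ge_trans hs)).
Qed.

Lemma lam1_le_frob : lam1 <= \sum_i \sum_j A i j ^+ 2.
Proof.
have [|v v0 Ev] := @gram_eigen lam1; first by rewrite eigs_root mem_head.
by have := frob_bound A v; rewrite Ev ler_pM2r.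
Qed.

End Eigenvalues.

Lemma l2normE m (x : 'cV[R]_m) : l2norm x^T = Num.sqrt (dotp x x).
Proof.
by rewrite /l2norm dotpE; congr Num.sqrt; apply: eq_bigr => j _; rewrite mxE expr2.
Qed.

(** Applied with L = lam1, this yields F / lam <= sr(A), so that the sample counts of the program
    stay below those of the claimed bound. *)
Lemma specnorm_le (L : R) : 0 <= L ->
  (forall x, dotp (A *m x) (A *m x) <= L * dotp x x) -> specnorm A ^+ 2 <= L.
Proof.
move=> L0 hL; have ub : ubound [set l2norm (A *m x)^T | x in
    [set x : 'cV[R]_d | l2norm x^T <= 1]]%classic (Num.sqrt L).
  move=> _ [x /= x1 <-]; rewrite l2normE ler_sqrt //.
  apply: le_trans (hL x) _; rewrite -[leRHS]mulr1 ler_wpM2l //.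
  move: x1; rewrite l2normE -[1 in X in X -> _]sqrtr1 ler_sqrt //.
have h0 : [set l2norm (A *m x)^T | x in
    [set x : 'cV[R]_d | l2norm x^T <= 1]]%classic 0.
  by exists 0 => /=; rewrite l2normE ?mulmx0 dotp0l sqrtr0.
rewrite -(sqr_sqrtr L0) ler_pXn2r ?nnegrE ?sqrtr_ge0 //.
  by apply: ge_sup ub; exists 0.
exact: (ub_le_sup (ex_intro _ _ ub)).
Qed.

(** Guards the division in [stable_rank], which would give 0 for a vanishing norm. *)
Lemma specnorm_gt0 i j : A i j != 0 -> 0 < specnorm A.
Proof.
move=> Aij; have hF := frob_bound A.
set F := \sum_i _ in hF.
have F0 : 0 <= F.
  by rewrite sumr_ge0 // => k _; rewrite sumr_ge0 // => l _; rewrite sqr_ge0.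
have ub : ubound [set l2norm (A *m x)^T | x in
    [set x : 'cV[R]_d | l2norm x^T <= 1]]%classic (Num.sqrt F).
  move=> _ [x /= x1 <-]; rewrite l2normE ler_sqrt //.
  apply: le_trans (hF x) _; rewrite -[leRHS]mulr1 ler_wpM2l //.
  move: x1; rewrite l2normE -[1 in X in X -> _]sqrtr1 ler_sqrt //.
apply: (@lt_le_trans _ _ (l2norm (A *m delta_mx j 0)^T)).
  rewrite l2normE sqrtr_gt0 dotp_mulmx_delta (bigD1 i) //=.
  rewrite ltr_pwDl ?exprn_even_gt0 // sumr_ge0 // => k _; exact: sqr_ge0.
apply: (ub_le_sup (ex_intro _ _ ub)); exists (delta_mx j 0) => //=.
rewrite l2normE dotpE (bigD1 j) //= big1 ?addr0; first by rewrite mxE !eqxx mulr1 sqrtr1.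
by move=> k /negbTE kj; rewrite mxE kj /= mulr0.
Qed.

End Spectral.

(** * Expected progress of one step *)

Section StepBound.
Variables (R : realType) (n d : nat) (A : 'M[R]_(n, d)).
Variables (lam1 lam g : R).
Let H := A^T *m A.
Let B := lam%:M - H.

Definition rowl1 (i : 'I_n) : R := \sum_j `|A i j|.
Definition rowl2 (i : 'I_n) : R := \sum_j A i j ^+ 2.
Definition frob2 : R := \sum_i rowl2 i.
Definition rowdot (i : 'I_n) (v : 'cV[R]_d) : R := \sum_j A i j * v j 0.
(** Multiplied by [rowl1 i], this is the second moment of the estimator a_ij v_j / p_j of <a_i, v>
    with p_j = |a_ij| / |a_i|_1. *)
Definition roww (i : 'I_n) (v : 'cV[R]_d) : R := \sum_j `|A i j| * v j 0 ^+ 2.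

Lemma rowl1_ge0 i : 0 <= rowl1 i.
Proof. exact: sumr_ge0. Qed.

Lemma rowl2_ge0 i : 0 <= rowl2 i.
Proof. by apply: sumr_ge0 => j _; exact: sqr_ge0. Qed.

Lemma frob2_ge0 : 0 <= frob2.
Proof. by apply: sumr_ge0 => i _; exact: rowl2_ge0. Qed.

Lemma roww_ge0 i v : 0 <= roww i v.
Proof. by apply: sumr_ge0 => j _; rewrite mulr_ge0 ?sqr_ge0. Qed.

Hypothesis gram_le : forall x, dotp (A *m x) (A *m x) <= lam1 * dotp x x.
Hypotheses (lam1_gt0 : 0 < lam1) (lam1_le : lam1 <= lam).

Let lam_gt0 : 0 < lam. Proof. exact: lt_le_trans lam1_le. Qed.

Lemma mulmx_gramE v : H *m v = \sum_i rowdot i v *: (row i A)^T.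
Proof.
rewrite /H -mulmxA; apply/matrixP => j z; rewrite ord1 mxE summxE.
apply: eq_bigr => i _; rewrite !mxE mulrC; congr (_ * _).
Qed.

Lemma sum_rowdot2 v : \sum_i rowdot i v ^+ 2 = dotp (A *m v) (A *m v).
Proof. by rewrite dotpE; apply: eq_bigr => i _; rewrite mxE -expr2. Qed.

Lemma dotp_row i : dotp (row i A)^T (row i A)^T = rowl2 i.
Proof. by rewrite dotpE; apply: eq_bigr => j _; rewrite !mxE expr2. Qed.

Lemma col_le j : \sum_i A i j ^+ 2 <= lam1.
Proof.
rewrite -dotp_mulmx_delta; apply: le_trans (gram_le _) _.
rewrite -[leRHS]mulr1 ler_wpM2l ?(ltW lam1_gt0) //.
rewrite dotpE (bigD1 j) //= big1 ?addr0; first by rewrite mxE !eqxx mulr1.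
by move=> k /negbTE kj; rewrite mxE kj /= mulr0.
Qed.

(** With y = A v and z = A^T y, |z|^4 = <A z, y>^2 <= |A z|^2 |y|^2 <= lam1 |z|^2 |y|^2; divide by
    |z|^2. *)
Lemma gram_sq_le v : dotp (H *m v) (H *m v) <= lam1 * dotp (A *m v) (A *m v).
Proof.
set y := A *m v; rewrite /H -mulmxA -/y; set z := A^T *m y.
have h1 : dotp z z = dotp (A *m z) y by rewrite {2}/z dotp_adj.
have h2 := cauchy_schwarz (A *m z) y; rewrite -h1 in h2.
have h3 := gram_le z.
have [z0|zn0] := eqVneq (dotp z z) 0.
  by rewrite z0 mulr_ge0 ?dotp_ge0 // ltW.
have zp : 0 < dotp z z by rewrite lt_neqAle eq_sym zn0 dotp_ge0.
rewrite -(ler_pM2l zp) -expr2; apply: le_trans h2 _.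
by rewrite mulrCA mulrA ler_wpM2r ?dotp_ge0 // .
Qed.

Lemma sqnormBE e : sqnorm B e = lam * dotp e e - dotp (A *m e) (A *m e).
Proof.
rewrite /sqnorm -mulmxA -[LHS]/(dotp e (B *m e)).
by rewrite /B mulmxBl mul_scalar_mx dotpDr dotpNr dotpZr /H -mulmxA dotp_adj.
Qed.

Lemma sqnormB_ge e : (lam - lam1) * dotp e e <= sqnorm B e.
Proof. by rewrite sqnormBE mulrBl lerD2l lerN2. Qed.

Lemma mulBE (e : 'cV[R]_d) : B *m e = lam *: e - H *m e.
Proof. by rewrite /B mulmxBl mul_scalar_mx. Qed.

(** The smoothness inequality of f. After expansion it reduces to |H e|^2 <= lam |A e|^2. *)
Lemma mulB_sq_le (e : 'cV[R]_d) : dotp (B *m e) (B *m e) <= lam * sqnorm B e.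
Proof.
rewrite sqnormBE mulBE dotpDl !dotpDr !dotpNl !dotpNr !dotpZl !dotpZr.
rewrite (dotpC (H *m e) e) /H -mulmxA dotp_adj.
have := gram_sq_le e; rewrite /H -mulmxA.
have := dotp_ge0 (A *m e); set a := dotp (A *m e) _.
set b := dotp (A^T *m _) _ => a0 hb.
have : b <= lam * a by apply: le_trans hb _; rewrite ler_wpM2r.
lra.
Qed.

(** * One descent step with sample counts [r] and row probabilities [q] *)

Section Rows.
Variables (r q : 'I_n -> R) (v : 'cV[R]_d).
Hypothesis r_gt0 : forall i, 0 < r i.
Hypothesis r_sparse : forall i, rowl1 i ^+ 2 <= rowl2 i * r i.
Hypothesis r_frob : forall i,
  rowl1 i * Num.sqrt frob2 <= Num.sqrt (rowl2 i) * Num.sqrt lam * r i.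
Hypothesis q_gt0 : forall i, 0 < q i.
Hypothesis q_ge : forall i, rowl2 i <= 2 * frob2 * q i.
Hypothesis frob2_gt0 : 0 < frob2.

(* Column by column: sum_i ||a_i|| |a_ij| is at most ||A||_F times the norm of
   the j-th column, hence at most ||A||_F sqrt(lam1). *)
Lemma sum_roww_le : \sum_i rowl1 i * roww i v / r i <= lam * dotp v v.
Proof.
set sF := Num.sqrt frob2; set sl := Num.sqrt lam.
have sF0 : 0 < sF by rewrite sqrtr_gt0.
have sl0 : 0 < sl by rewrite sqrtr_gt0.
have sF2 : sF ^+ 2 = frob2 by rewrite sqr_sqrtr // ltW.
have sl2 : sl ^+ 2 = lam by rewrite sqr_sqrtr // ltW.
apply: (@le_trans _ _ (\sum_i sl / sF * (Num.sqrt (rowl2 i) * roww i v))).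
  apply: ler_sum => i _; rewrite ler_pdivrMr //.
  have -> : sl / sF * (Num.sqrt (rowl2 i) * roww i v) * r i =
     (Num.sqrt (rowl2 i) * sl * r i) / sF * roww i v by ring.
  by rewrite ler_wpM2r ?roww_ge0 // ler_pdivlMr.
rewrite -mulr_sumr.
have -> : \sum_i Num.sqrt (rowl2 i) * roww i v =
    \sum_j (\sum_i Num.sqrt (rowl2 i) * `|A i j|) * v j 0 ^+ 2.
  under eq_bigr => i _ do rewrite mulr_sumr.
  rewrite exchange_big /=; apply: eq_bigr => j _; rewrite mulr_suml.
  by apply: eq_bigr => i _; rewrite mulrA.
have hcol j : \sum_i Num.sqrt (rowl2 i) * `|A i j| <= sF * sl.
  have hcs : (\sum_i Num.sqrt (rowl2 i) * `|A i j|) ^+ 2 <= frob2 * lam1.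
    have := cauchy_schwarz (\col_i Num.sqrt (rowl2 i)) (\col_i `|A i j|).
    rewrite !dotpE.
    under eq_bigr => i _ do rewrite !mxE.
    under [X in _ <= X * _ -> _]eq_bigr => i _ do rewrite !mxE -expr2 sqr_sqrtr ?rowl2_ge0 //.
    under [X in _ <= _ * X -> _]eq_bigr => i _ do rewrite !mxE -expr2 -normrX ger0_norm ?sqr_ge0 //.
    move=> h; apply: le_trans h _; rewrite ler_wpM2l //.
      exact: frob2_ge0.
    exact: col_le.
  have hsq : (\sum_i Num.sqrt (rowl2 i) * `|A i j|) ^+ 2 <= (sF * sl) ^+ 2.
    apply: le_trans hcs _; rewrite exprMn sF2 sl2 ler_wpM2l //.
    exact: frob2_ge0.
  rewrite ler_pXn2r ?nnegrE // ?mulr_ge0 ?sqrtr_ge0 // in hsq.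
  by apply: sumr_ge0 => i _; rewrite mulr_ge0 ?sqrtr_ge0.
apply: (@le_trans _ _ (sl / sF * \sum_j sF * sl * v j 0 ^+ 2)).
  rewrite ler_wpM2l ?divr_ge0 ?sqrtr_ge0 //; apply: ler_sum => j _.
  by rewrite ler_wpM2r ?sqr_ge0.
rewrite -mulr_sumr mulrA -sl2 dotpE.
under [X in _ <= _ * X]eq_bigr => j _ do rewrite -expr2.
rewrite ler_wpM2r ?sumr_ge0 //; first by move=> j _; exact: sqr_ge0.
by rewrite le_eqVlt; apply/orP; left; apply/eqP; field; rewrite gt_eqF.
Qed.

(** The factors are second moments of the estimates of a_i and of <a_i, v>. The first is at most 3
    |a_i|^2, and dividing by q_i turns this into 6 F; the second sums to at most 3 lam |v|^2. *)
Lemma sum_second_moment_le :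
  \sum_i (q i)^-1 * ((rowl2 i + 2 * rowl1 i ^+ 2 / r i) *
     (rowdot i v ^+ 2 + 2 * rowl1 i * roww i v / r i))
  <= 18 * frob2 * lam * dotp v v.
Proof.
apply: (@le_trans _ _ (\sum_i 6 * frob2 *
    (rowdot i v ^+ 2 + 2 * (rowl1 i * roww i v / r i)))).
  apply: ler_sum => i _.
  have -> : 2 * rowl1 i * roww i v / r i = 2 * (rowl1 i * roww i v / r i) by ring.
  rewrite [(q i)^-1 * _]mulrA ler_wpM2r //.
    by rewrite addr_ge0 ?sqr_ge0 // mulr_ge0 // !mulr_ge0 ?rowl1_ge0 ?roww_ge0
       ?invr_ge0 // ltW.
  rewrite mulrC ler_pdivrMr //.
  have h1 : 2 * rowl1 i ^+ 2 / r i <= 2 * rowl2 i.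
    by rewrite ler_pdivrMr // -mulrA ler_wpM2l.
  by have := q_ge i; lra.
rewrite -mulr_sumr big_split /= -mulr_sumr sum_rowdot2.
have h1 := gram_le v; have h2 := sum_roww_le.
have h3 : lam1 * dotp v v <= lam * dotp v v by rewrite ler_wpM2r ?dotp_ge0.
have -> : 18 * frob2 * lam * dotp v v = 6 * frob2 * (3 * (lam * dotp v v)) by ring.
by rewrite ler_wpM2l ?mulr_ge0 ?frob2_ge0 //; lra.
Qed.

Variables (vs : 'cV[R]_d) (eta : R).
Hypotheses (g_gt0 : 0 < g) (eta_def : eta = g / (100 * 100 * 5 * frob2)).
Hypothesis mu_ge : lam * g / 152 <= lam - lam1.
Hypothesis frob_lam : lam * g <= 2 * frob2.

(** Bounds the expectation of |y + k D u|^2 once row i is accepted, where D and u are independent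
    averages of [r i] samples estimating <a_i, v> and a_i. The factor k = eta / q_i makes the step
    unbiased; the factors 2 pay for rounding in the sampling tables. *)
Definition row_moment (y : 'cV[R]_d) (i : 'I_n) : R :=
  let k := eta / q i in let a := (row i A)^T in
  dotp (y + (k * rowdot i v) *: a) (y + (k * rowdot i v) *: a)
  + k ^+ 2 * rowdot i v ^+ 2 * (2 * rowl1 i ^+ 2) / r i
  + k ^+ 2 * (rowl2 i + 2 * rowl1 i ^+ 2 / r i) * (2 * rowl1 i * roww i v) / r i.

Lemma row_moment_ge0 y i : 0 <= row_moment y i.
Proof.
have r0 := ltW (r_gt0 i); have w0 := roww_ge0 i v; have l0 := rowl1_ge0 i.
have l20 := rowl2_ge0 i.
rewrite /row_moment; apply: addr_ge0; first apply: addr_ge0.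
- exact: dotp_ge0.
- apply: divr_ge0 => //; apply: mulr_ge0; first by apply: mulr_ge0; exact: sqr_ge0.
  by apply: mulr_ge0 => //; exact: sqr_ge0.
- apply: divr_ge0 => //; apply: mulr_ge0; last by rewrite !mulr_ge0.
  apply: mulr_ge0; first exact: sqr_ge0.
  apply: addr_ge0 => //; apply: divr_ge0 => //; apply: mulr_ge0 => //.
  exact: sqr_ge0.
Qed.

(** Positions are relative to x0, so v = x - x0, vs = x* - x0 and the gradient at x0 is - B vs. The
    point [y0] is the error after the deterministic part of the step; adding the mean eta H v of the
    random part gives e - eta B e. With probability 1 - sum q no row is accepted and the random part
    is 0. *)
Lemma sum_row_moment_le y0 :
  y0 = (1 - eta * lam) *: v + eta *: (B *m vs) - vs ->
  \sum_i q i * row_moment y0 i + (1 - \sum_i q i) * dotp y0 y0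
  <= dotp (v - vs) (v - vs) - eta * sqnorm B (v - vs)
     + eta / 8 * sqnorm B vs.
Proof.
have eta_gt0 : 0 < eta by rewrite eta_def divr_gt0 // !mulr_gt0.
have E1 : \sum_i q i * row_moment y0 i + (1 - \sum_i q i) * dotp y0 y0 =
    dotp y0 y0 + 2 * eta * dotp y0 (H *m v) + eta ^+ 2 *
   \sum_i (q i)^-1 * ((rowl2 i + 2 * rowl1 i ^+ 2 / r i) *
     (rowdot i v ^+ 2 + 2 * rowl1 i * roww i v / r i)).
  have -> : \sum_i q i * row_moment y0 i = \sum_i (q i * dotp y0 y0 +
     (2 * eta * dotp y0 (rowdot i v *: (row i A)^T) + eta ^+ 2 *
      ((q i)^-1 * ((rowl2 i + 2 * rowl1 i ^+ 2 / r i) *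
       (rowdot i v ^+ 2 + 2 * rowl1 i * roww i v / r i))))).
    apply: eq_bigr => i _; rewrite /row_moment dotpDl !dotpDr !dotpZl !dotpZr.
    rewrite dotp_row (dotpC _ y0); field.
    by rewrite !gt_eqF.
  rewrite !big_split /= -mulr_suml -!mulr_sumr mulmx_gramE dotp_sumr; ring.
move=> y0_def; rewrite E1.
have hS := sum_second_moment_le.
set e := v - vs.
(* The two sides differ by the square eta^2 |H v|^2. *)
have E2 : dotp y0 y0 + 2 * eta * dotp y0 (H *m v) <=
    dotp (e - eta *: (B *m e)) (e - eta *: (B *m e)).
  have -> : e - eta *: (B *m e) = y0 + eta *: (H *m v).
    rewrite /e y0_def mulmxBr !mulBE; apply/matrixP => a b; rewrite !mxE; ring.
  rewrite [leRHS]dotpDl !dotpDr !dotpZl !dotpZr (dotpC _ y0).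
  have : 0 <= eta * (eta * dotp (H *m v) (H *m v)).
    by rewrite !mulr_ge0 ?dotp_ge0 // ltW.
  lra.
have ve : v = e + vs by rewrite /e subrK.
clearbody e.
have E3 : dotp (e - eta *: (B *m e)) (e - eta *: (B *m e)) =
    dotp e e - 2 * eta * sqnorm B e + eta ^+ 2 * dotp (B *m e) (B *m e).
  rewrite dotpDl !dotpDr !dotpNl !dotpNr !dotpZl !dotpZr (dotpC _ e).
  by rewrite /sqnorm -[(e^T *m B *m e)]mulmxA -/(dotp e (B *m e)); ring.
have h1 := mulB_sq_le e.
have mu_gt0 : 0 < lam * g / 152 by rewrite divr_gt0 // mulr_gt0.
have he : lam * g / 152 * dotp e e <= sqnorm B e.
  by apply: le_trans (sqnormB_ge e); rewrite ler_wpM2r ?dotp_ge0.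
have hs : lam * g / 152 * dotp vs vs <= sqnorm B vs.
  by apply: le_trans (sqnormB_ge vs); rewrite ler_wpM2r ?dotp_ge0.
have hv : dotp v v <= 2 * dotp e e + 2 * dotp vs vs.
  have := dotp_ge0 (e - vs).
  by rewrite ve !dotpDl !dotpDr !dotpNl !dotpNr (dotpC vs e); lra.
have Be0 : 0 <= sqnorm B e by apply: le_trans he; rewrite mulr_ge0 ?dotp_ge0 ?ltW.
have Bs0 : 0 <= sqnorm B vs by apply: le_trans hs; rewrite mulr_ge0 ?dotp_ge0 ?ltW.
(* Strong convexity converts |v|^2 into B-norms. The constant 50000 in [eta] ensures 18 * 2 * 152 /
   50000 < 1 / 8. *)
have hv2 : 18 * frob2 * lam * dotp v v * eta <=
    (sqnorm B e + sqnorm B vs) / 8.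
  have -> : 18 * frob2 * lam * dotp v v * eta = 18 * lam * g / (100 * 100 * 5) * dotp v v.
    by rewrite eta_def; field; rewrite gt_eqF.
  apply: (@le_trans _ _ (18 * lam * g / (100 * 100 * 5) * (2 * dotp e e + 2 * dotp vs vs))).
    by rewrite ler_wpM2l // divr_ge0 // !mulr_ge0 // ltW.
  have -> : 18 * lam * g / (100 * 100 * 5) * (2 * dotp e e + 2 * dotp vs vs) =
     (18 * 2 * 152 / (100 * 100 * 5)) * (lam * g / 152 * dotp e e + lam * g / 152 * dotp vs vs)
     by field.
  lra.
have hl : eta * lam <= 1 / 8.
  have -> : eta * lam = (lam * g) / ((100 * 100 * 5) * frob2).
    by rewrite eta_def; field; rewrite gt_eqF.
  rewrite ler_pdivrMr ?mulr_gt0 //; apply: le_trans frob_lam _.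
  by rewrite [1 / 8 * _]mulrA ler_pM2r //; lra.
have h2 : eta ^+ 2 * dotp (B *m e) (B *m e) <= eta * (1 / 8 * sqnorm B e).
  rewrite expr2 -mulrA ler_pM2l //.
  apply: (@le_trans _ _ (eta * (lam * sqnorm B e))).
    by rewrite ler_pM2l.
  by rewrite mulrA ler_wpM2r.
have h3 : eta ^+ 2 * (18 * frob2 * lam * dotp v v) <=
    eta * ((sqnorm B e + sqnorm B vs) / 8).
  by rewrite expr2 -mulrA ler_pM2l // mulrC.
have h4 : eta ^+ 2 * (\sum_i (q i)^-1 * ((rowl2 i + 2 * rowl1 i ^+ 2 / r i) *
     (rowdot i v ^+ 2 + 2 * rowl1 i * roww i v / r i))) <=
     eta ^+ 2 * (18 * frob2 * lam * dotp v v).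
  by rewrite ler_wpM2l ?sqr_ge0.
have h5 : 0 <= eta * sqnorm B e by rewrite mulr_ge0 // ltW.
lra.
Qed.

End Rows.
End StepBound.

(** Move from x along the residual h = B x - c: twice the change of the objective is 2 t |h|^2 + t^2
    <h, B h>, and nonnegativity for all t forces h = 0. The absolute value in the bound spares a
    positivity assumption on B. *)
Lemma argmin_solves (R : realType) m (B : 'M[R]_m) (c x : 'cV[R]_m) :
  B^T = B -> is_argmin (quad_obj B c) x -> B *m x = c.
Proof.
move=> symB hmin; apply/eqP; rewrite -subr_eq0; apply/eqP.
set h := B *m x - c; apply: dotp_eq0.
have objE y : quad_obj B c y = 2^-1 * dotp y (B *m y) - dotp c y.
  by rewrite /quad_obj -mulmxA.
have hx : dotp h h = dotp h (B *m x) - dotp c h.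
  by rewrite {2}/h dotpDr dotpNr (dotpC h c).
clearbody h.
have H t : 0 <= 0 + 2 * t * dotp h h + t ^+ 2 * `|dotp h (B *m h)|.
  have := hmin (x + t *: h); rewrite !objE mulmxDr -scalemxAr.
  rewrite !dotpDr !dotpDl !dotpZr !dotpZl.
  have -> : dotp x (B *m h) = dotp h (B *m x).
    by rewrite -{1}symB dotp_adj dotpC.
  have : t ^+ 2 * dotp h (B *m h) <= t ^+ 2 * `|dotp h (B *m h)|.
    by rewrite ler_wpM2l ?sqr_ge0 // ler_norm.
  have : t * dotp h h = t * dotp h (B *m x) - t * dotp c h by rewrite {1}hx; ring.
  lra.
have := discr_le (normr_ge0 _) H; rewrite mul0r.
by rewrite -[X in _ <= X -> _](expr0n _ 2) => h2; apply/eqP; rewrite -sqrf_eq0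
  eq_le sqr_ge0 andbT; move: h2; rewrite expr0n.
Qed.

(** * The program *)

Local Notation nv a := (NLoad a (NConst 0) (NConst 0)).
Local Notation rv a := (RLoad a (NConst 0) (NConst 0)).
Local Notation nst a e := (NStore a (NConst 0) (NConst 0) e).
Local Notation rst a e := (RStore a (NConst 0) (NConst 0) e).
Local Notation rc m := (RNat (NConst m)).
Local Notation "c1 ;; c2" := (Seq c1 c2) (at level 61, right associativity).

Section Program.

(* Integer arrays: 4, 5, 6 are the sampling tables of the rows (slots, number
   of slots of each entry, total number of slots); 7, 8, 9 the sampling table
   over the rows.  Integer variables: 20 i, 21 k, 22 remaining iterations,
   23 sampled slot, 24 acceptance bit, 25 number of samples, 26 sample counter,
   27 table length, 28 slot counter.
   Real arrays: 4, 5 the l1 norms and squared l2 norms of the rows; 7 the vector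
   A^T A x0; 8 the squared Frobenius norm F; 9 and 10 the two sums giving
   R = [sum_i |a_i|^2 rho_i]; 11 the step size; 12 the sampling budget; 13 the
   sparse vector w.  Real variables: 20 beta, 21 sigma, 23 budget spent,
   24 inner product estimate, 25 scaling of the sampled row, 30-32 row sums.
   The current iterate is x0 + beta (B x0 - c) + sigma w. *)

Let entry_ik := RLoad 1 (nv 20) (nv 21).
Let col_ik := NLoad 2 (nv 20) (nv 21).
Let nnz_i := NLoad 1 (nv 20) (NConst 0).

Definition row_sums_body : cmd :=
  rst 30 (RAdd (rv 30) (RSqrt (RMul entry_ik entry_ik))) ;;
  rst 31 (RAdd (rv 31) (RMul entry_ik entry_ik)) ;;
  rst 32 (RAdd (rv 32) (RMul entry_ik (RLoad 3 col_ik (NConst 0)))) ;;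
  nst 21 (NAdd (nv 21) (NConst 1)).

Definition slot_body at_ er ek : cmd :=
  NStore at_ er (nv 27) ek ;;
  nst 27 (NAdd (nv 27) (NConst 1)) ;;
  nst 28 (NAdd (nv 28) (NConst 1)).

(** Reals cannot be converted to integers, so the ceiling of the weight is found by counting up
    against it, one slot being filled per count. *)
Definition slots at_ ac er ek ew : cmd :=
  nst 28 (NConst 0) ;;
  While (BRLt (RNat (nv 28)) ew) (slot_body at_ er ek) ;;
  NStore ac er ek (nv 28).

(** Normalised so that the weights of a row average to 1. The absolute value is expressed as a
    square root of a square. *)
Definition entry_weight : rexpr :=
  RDiv (RMul (RNat nnz_i) (RSqrt (RMul entry_ik entry_ik))) (rv 30).

Definition row_table_body : cmd :=
  RStore 7 col_ik (NConst 0)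
    (RAdd (RLoad 7 col_ik (NConst 0)) (RMul entry_ik (rv 32))) ;;
  slots 4 5 (nv 20) (nv 21) entry_weight ;;
  nst 21 (NAdd (nv 21) (NConst 1)).

Definition row_init : cmd :=
  nst 21 (NConst 0) ;; rst 30 (rc 0) ;; rst 31 (rc 0) ;; rst 32 (rc 0).

Definition row_mid : cmd := nst 21 (NConst 0) ;; nst 27 (NConst 0).

Definition row_end : cmd :=
  NStore 6 (nv 20) (NConst 0) (nv 27) ;;
  RStore 4 (nv 20) (NConst 0) (rv 30) ;;
  RStore 5 (nv 20) (NConst 0) (rv 31) ;;
  rst 8 (RAdd (rv 8) (rv 31)) ;;
  rst 9 (RAdd (rv 9) (RMul (rv 30) (rv 30))) ;;
  rst 10 (RAdd (rv 10) (RMul (rv 30) (RSqrt (rv 31)))) ;;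
  nst 20 (NAdd (nv 20) (NConst 1)).

(** Two passes over the row: the table weights and the contribution to A^T A x0 use the l1 norm and
    the inner product with x0 of the whole row. *)
Definition row_body : cmd :=
  row_init ;; While (BNLt (nv 21) nnz_i) row_sums_body ;;
  row_mid ;; While (BNLt (nv 21) nnz_i) row_table_body ;;
  row_end.

Let nrows := NLoad 0 (NConst 0) (NConst 0).

Definition row_weight : rexpr :=
  RDiv (RMul (RNat nrows) (RLoad 5 (nv 20) (NConst 0))) (rv 8).

Definition rows_table_body : cmd :=
  slots 7 8 (NConst 0) (nv 20) row_weight ;;
  nst 20 (NAdd (nv 20) (NConst 1)).

Let lam_ := rv 0.
Let gap_ := RLoad 0 (NConst 0) (NConst 1).

Definition iterations : rexpr :=
  RDiv (RMul (RMul (RMul (RMul (rc 100) (rc 100)) (rc 100)) (rc 100)) (rv 8))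
    (RMul lam_ (RMul gap_ gap_)).

(** Array 12 receives four times the iteration count times R / F, a bound on the expected number of
    samples charged per iteration. *)
Definition main_init : cmd :=
  rst 11 (RDiv gap_ (RMul (RMul (RMul (rc 100) (rc 100)) (rc 5)) (rv 8))) ;;
  rst 12 (RDiv (RMul (RMul (rc 4) (RNat (nv 22)))
    (RAdd (rv 9) (RMul (RSqrt (RDiv (rv 8) lam_)) (rv 10)))) (rv 8)) ;;
  rst 20 (rc 0) ;; rst 21 (rc 1) ;; rst 23 (rc 0).

Definition preprocess : cmd :=
  While (BNLt (nv 20) nrows) row_body ;;
  (nst 20 (NConst 0) ;; nst 27 (NConst 0)) ;;
  While (BNLt (nv 20) nrows) rows_table_body ;;
  (nst 9 (nv 27) ;; nst 22 (NConst 0)) ;;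
  While (BRLt (RNat (nv 22)) iterations) (nst 22 (NAdd (nv 22) (NConst 1))) ;;
  main_init.

Let l1_i := RLoad 4 (nv 20) (NConst 0).
Let l2_i := RLoad 5 (nv 20) (NConst 0).

(** Coordinate j of x - x0, evaluated on demand in constant time. *)
Definition iterate_at (j : nexpr) : rexpr :=
  RAdd (RMul (rv 20) (RSub (RSub (RMul lam_ (RLoad 3 j (NConst 0)))
    (RLoad 7 j (NConst 0))) (RLoad 2 j (NConst 0))))
    (RMul (rv 21) (RLoad 13 j (NConst 0))).

Definition samples_needed : rexpr :=
  RAdd (RDiv (RMul l1_i l1_i) l2_i)
    (RMul (RDiv l1_i (RSqrt l2_i)) (RSqrt (RDiv (rv 8) lam_))).

(** [Unif] includes its upper bound, hence the decrement. *)
Definition sample_entry : cmd :=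
  Unif 23 (NConst 0) (NConst 0)
    (NSub (NLoad 6 (nv 20) (NConst 0)) (NConst 1)).

(** The entry divided by its actual probability in the table, so rounding of the weights causes no
    bias. *)
Let slot_value := RDiv (RMul (RNat (NLoad 6 (nv 20) (NConst 0))) entry_ik)
  (RNat (NLoad 5 (nv 20) (nv 21))).

Definition dot_body : cmd :=
  sample_entry ;;
  nst 21 (NLoad 4 (nv 20) (nv 23)) ;;
  rst 24 (RAdd (rv 24) (RMul slot_value (iterate_at col_ik))) ;;
  nst 25 (NAdd (nv 25) (NConst 1)).

Definition vec_body : cmd :=
  sample_entry ;;
  nst 21 (NLoad 4 (nv 20) (nv 23)) ;;
  RStore 13 col_ik (NConst 0)
    (RAdd (RLoad 13 col_ik (NConst 0)) (RMul (rv 25) slot_value)) ;;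
  nst 26 (NAdd (nv 26) (NConst 1)).

(** The part of the gradient step that touches all coordinates, done on the two scalars only. *)
Definition decay : cmd :=
  rst 20 (RSub (RMul (RSub (rc 1) (RMul (rv 11) lam_)) (rv 20)) (rv 11)) ;;
  rst 21 (RMul (RSub (rc 1) (RMul (rv 11) lam_)) (rv 21)).

(** With both coefficients zero the output is x0, and the zero counter ends the main loop. *)
Definition abort : cmd := nst 22 (NConst 0) ;; rst 20 (rc 0) ;; rst 21 (rc 0).

(** Array 24 accumulates a sum, so in the coefficient 25 one division by the number of samples
    averages the inner product and the other averages the sampled row; dividing by sigma undoes the
    scaling of w. *)
Definition row_update : cmd :=
  (rst 23 (RAdd (rv 23) samples_needed) ;; rst 24 (rc 0) ;; nst 25 (NConst 0) ;;
   nst 26 (NConst 0)) ;;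
  While (BRLt (RNat (nv 25)) samples_needed) dot_body ;;
  (decay ;;
   rst 25 (RDiv (RMul (RMul (RMul (rv 11) (rv 8)) (RNat (nv 9))) (rv 24))
     (RMul (RMul (RMul (RMul (RNat nrows) l2_i) (RNat (nv 25))) (RNat (nv 25)))
       (rv 21)))) ;;
  While (BNLt (nv 26) (nv 25)) vec_body.

(** A uniform slot gives row i with probability proportional to its rounded slot count; the coin
    corrects this to a probability exactly proportional to |a_i|^2. The budget is tested before any
    sample is drawn. *)
Definition iteration : cmd :=
  nst 22 (NSub (nv 22) (NConst 1)) ;;
  Unif 23 (NConst 0) (NConst 0) (NSub (nv 9) (NConst 1)) ;;
  nst 20 (NLoad 7 (NConst 0) (nv 23)) ;;
  Flip 24 (NConst 0) (NConst 0) (RDiv (RMul (RNat nrows) l2_i)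
    (RMul (rv 8) (RNat (NLoad 8 (NConst 0) (nv 20))))) ;;
  If (BNLt (nv 24) (NConst 1)) decay
    (If (BRLt (rv 12) (RAdd (rv 23) samples_needed)) abort row_update).

(** The draw is 0 with probability 1 / m when m iterations remain, and certainly so when m = 1. *)
Definition main_body : cmd :=
  Unif 23 (NConst 0) (NConst 0) (NSub (nv 22) (NConst 1)) ;;
  If (BNLt (nv 23) (NConst 1)) (nst 22 (NConst 0)) iteration.

Definition solver : program :=
  Program (preprocess ;; While (BNLt (NConst 0) (nv 22)) main_body)
    (RAdd (RLoad 3 (nv 3) (NConst 0)) (iterate_at (nv 3))).

End Program.

(** * Straight-line code *)

Section Straight.
Variables (R : realType) (phi : state R -> R).

Fixpoint straight (c : cmd) : bool :=
  match c with
  | NStore _ _ _ _ | RStore _ _ _ _ => true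
  | Seq c1 c2 => straight c1 && straight c2
  | _ => false
  end.

Fixpoint effect (c : cmd) (s : state R) : state R :=
  match c with
  | NStore a i j e => nset s a (neval s i) (neval s j) (neval s e)
  | RStore a i j e => rset s a (neval s i) (neval s j) (reval s e)
  | Seq c1 c2 => effect c2 (effect c1 s)
  | _ => s
  end.

Fixpoint cost (c : cmd) : nat :=
  if c is Seq c1 c2 then (cost c1 + cost c2).+1 else 1%N.

Lemma ok_straight c k s tau v : straight c ->
  ok phi tau k (effect c s) v -> ok phi (tau + (cost c)%:R) (c :: k) s v.
Proof.
elim: c k s tau => //= [a i j e|a i j e|c1 IH1 c2 IH2] k s tau.
- by move=> _; apply: ok_nstore.
- by move=> _; apply: ok_rstore.
move=> /andP[s1 s2] hok; rewrite -addn1 natrD addrA; apply: ok_seq.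
by rewrite natrD [_ + (cost c2)%:R]addrC addrA; apply: IH1 => //; apply: IH2.
Qed.

Lemma spec_straight (P Q : state R -> Prop) c : straight c ->
  (forall s, P s -> Q (effect c s)) -> spec phi P c (cost c)%:R Q.
Proof. by move=> hc h s k tau v Ps hk; apply: ok_straight => //; apply/hk/h. Qed.

Lemma spec_fix (P Q : state R -> Prop) c b :
  (forall s, P s -> spec phi (eq s) c b Q) -> spec phi P c b Q.
Proof. by move=> h s k tau v Ps hk; exact: (h s Ps s k tau v erefl hk). Qed.

End Straight.

(** * Sampling tables *)

Section Tables.
Variables (R : realType).

Lemma sum_const m (c : R) : \sum_(k < m) c = m%:R * c.
Proof. by rewrite sumr_const card_ord mulr_natl. Qed.

Definition nceil (x : R) : nat := `|Num.ceil x|%N.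

Lemma ltr_nceil (x : R) (k : nat) : 0 <= x -> (k%:R < x) = (k < nceil x)%N.
Proof.
move=> x0; have c0 : 0 <= Num.ceil x by rewrite ceil_ge0 (lt_le_trans _ x0) // oppr_lt0.
rewrite /nceil -ltz_nat gez0_abs //.
by rewrite ceil_gt_int.
Qed.

Lemma ler_nceil (x : R) : 0 <= x -> x <= (nceil x)%:R.
Proof. by move=> x0; rewrite leNgt ltr_nceil // ltnn. Qed.

Lemma nceil_le (x : R) : 0 <= x -> (nceil x)%:R <= x + 1.
Proof.
move=> x0; case E: (nceil x) => [|k]; first by rewrite addr_ge0.
by rewrite -natr1 lerD2r ltW // ltr_nceil // E.
Qed.

(** [table_sum] says that k occupies [cnt k] slots, in the form used to average over a uniform slot.
    Rounding up gives the lower bound on counts and an excess of at most one slot per entry. *)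
Record table (tab cnt : nat -> nat) (L K : nat) (W : nat -> R) : Prop := Table {
  table_sum : forall G : nat -> R,
    \sum_(u < L) G (tab u) = \sum_(k < K) (cnt k)%:R * G k;
  table_lt : forall u, (u < L)%N -> (tab u < K)%N;
  table_ge : forall k, (k < K)%N -> W k <= (cnt k)%:R;
  table_len : L%:R <= \sum_(k < K) (W k + 1) }.

Lemma table0 tab cnt W : table tab cnt 0 0 W.
Proof. by split=> // [G|]; rewrite !big_ord0. Qed.

Lemma tableS tab cnt tab' cnt' L K W : 0 <= W K ->
  (forall u, tab' u = if (L <= u < L + nceil (W K))%N then K else tab u) ->
  (forall k, cnt' k = if k == K then nceil (W K) else cnt k) ->
  table tab cnt L K W -> table tab' cnt' (L + nceil (W K)) K.+1 W.
Proof.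
move=> W0 Et Ec [h1 h2 h3 h4]; split.
- move=> G; rewrite big_split_ord /= big_ord_recr /= Ec eqxx; congr (_ + _).
    transitivity (\sum_(u < L) G (tab u)).
      by apply: eq_bigr => u _; rewrite Et leqNgt ltn_ord.
    by rewrite h1; apply: eq_bigr => k _; rewrite Ec ltn_eqF.
  under eq_bigr => u _ do rewrite Et leq_addr ltn_add2l ltn_ord /=.
  by rewrite big_const_ord iter_addr_0 mulr_natl.
- move=> u hu; rewrite Et hu andbT; case: (leqP L u) => // hL.
  by rewrite ltnS ltnW // h2.
- move=> k; rewrite ltnS leq_eqVlt Ec; case: eqP => [->|_] /=.
    by rewrite ler_nceil.
  exact: h3.
- by rewrite natrD big_ord_recr /= lerD // nceil_le.
Qed.

End Tables.

(** * Filling a table *)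

Section Slots.
Variables (R : realType) (phi : state R -> R).

Definition same (LN LR : seq nat) (s s' : state R) : Prop :=
  (forall a, a \notin LN -> nmem s' a = nmem s a) /\
  (forall a, a \notin LR -> rmem s' a = rmem s a).

Lemma upd_ne V (m : nat -> nat -> nat -> V) a i k v a' :
  a' != a -> upd m a i k v a' = m a'.
Proof. by move=> /negbTE ne; rewrite /upd ne /=; apply/funext. Qed.

Lemma upd_eq V (m : nat -> nat -> nat -> V) a i k v i' k' :
  upd m a i k v a i' k' = if (i' == i) && (k' == k) then v else m a i' k'.
Proof. by rewrite /upd eqxx. Qed.

Lemma same_nset LN LR s s' a i k v :
  a \in LN -> same LN LR s s' -> same LN LR s (nset s' a i k v).
Proof.
move=> aL [h1 h2]; split=> // a' a'L; rewrite -h1 //=; apply: upd_ne.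
by apply: contraNneq a'L => ->.
Qed.

Variables (at_ ac : nat) (er ek : nexpr) (ew : rexpr) (s1 : state R).
Variables (rho kk : nat) (W : R).
Hypothesis uniq_arr : uniq [:: at_; ac; 27; 28].
Hypothesis stable : forall s, same [:: at_; ac; 27; 28] [::] s1 s ->
  [/\ neval s er = rho, neval s ek = kk & reval s ew = W].
Hypothesis W_ge0 : 0 <= W.
Let L := nmem s1 27 0 0.

Definition slots_post (s : state R) : Prop :=
  [/\ same [:: at_; ac; 27; 28] [::] s1 s,
      nmem s 27 0 0 = (L + nceil W)%N,
      forall i u, nmem s at_ i u =
        if (i == rho) && (L <= u < L + nceil W)%N then kk else nmem s1 at_ i u
    & forall i k, nmem s ac i k =
        if (i == rho) && (k == kk) then nceil W else nmem s1 ac i k].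

(** By [stable], the addressing and weight expressions keep their values while the table is written.
    Each of the at most W + 1 slots costs 6 steps. *)
Lemma slots_spec : spec phi (eq s1) (slots at_ ac er ek ew) (6 * W + 11) slots_post.
Proof.
have [at_ac [at27 [at28 [ac27 ac28]]]] : at_ != ac /\ at_ != 27 /\ at_ != 28 /\
    ac != 27 /\ ac != 28.
  move: uniq_arr; rewrite /= !inE !negb_or => /andP[/and3P[-> -> ->]].
  by case/andP => /andP[-> ->].
(* The loop invariant after [c] slots; the final count is stored only after the loop. *)
pose J c s := [/\ same [:: at_; ac; 27; 28] [::] s1 s,
      nmem s 28 0 0 = c, nmem s 27 0 0 = (L + c)%N,
      forall i u, nmem s at_ i u =
        if (i == rho) && (L <= u < L + c)%N then kk else nmem s1 at_ i u
    & nmem s ac = nmem s1 ac].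
have h1 : spec phi (eq s1) (nst 28 (NConst 0)) 1 (J 0%N).
  apply: spec_nstore => _ <-; split=> //=.
  - by apply: same_nset => //; rewrite !inE eqxx !orbT.
  - by rewrite addn0.
  - by move=> i u; rewrite addn0 upd_ne // ltnNge andbN andbF.
  - by rewrite upd_ne.
have h2 : spec phi (J 0%N) (While (BRLt (RNat (nv 28)) ew) (slot_body at_ er ek))
    (\sum_(k < nceil W) (5 + 1) + 1) (J (nceil W)).
  apply: (@spec_while _ _ (nceil W) J (fun=> 5)).
    move=> c s _ [hs h28 _ _ _] /=; have [_ _ ->] := stable hs.
    by rewrite h28 ltr_nceil.
  move=> c _; apply: (@spec_straight _ _ _ _ (slot_body at_ er ek)) => // s.
  move=> [hs h28 h27 hat hac].
  have mem4 : [&& at_ \in [:: at_; ac; 27; 28], 27 \in [:: at_; ac; 27; 28]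
     & 28 \in [:: at_; ac; 27; 28]] by rewrite !inE !eqxx !orbT.
  have [m1 m2 m3] := and3P mem4.
  have [Eer Eek _] := stable hs.
  rewrite /slot_body /= Eer Eek h27.
  split=> /=.
  - by do 3!apply: same_nset => //.
  - by rewrite !upd_eq !eqxx /= !upd_ne // 1?eq_sym // h28 addn1.
  - by rewrite upd_ne // upd_eq !eqxx /= upd_ne ?h27 1?eq_sym // addn1 addnS.
  - move=> i u; rewrite upd_ne // upd_ne // upd_eq hat.
    case: eqP => //= _; rewrite addnS ltnS.
    by case: (ltngtP u (L + c)%N) => [||->]; rewrite ?andbF ?leq_addr //=; lia.
  - by rewrite !upd_ne // eq_sym.
have h3 : spec phi (J (nceil W)) (NStore ac er ek (nv 28)) 1 slots_post.
  apply: spec_nstore => s [hs h28 h27 hat hac].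
  have [-> -> _] := stable hs; split=> /=.
  - by apply: same_nset => //; rewrite !inE eqxx !orbT.
  - by rewrite upd_ne // eq_sym.
  - by move=> i u; rewrite upd_ne.
  - by move=> i k; rewrite upd_eq h28 hac.
apply: spec_weaken (spec_seq h1 (spec_seq h2 h3)) => //.
rewrite sum_const.
by have := nceil_le W_ge0; lra.
Qed.

End Slots.

(** * Preprocessing *)

Section Preprocess.
Variables (R : realType) (phi : state R -> R) (s0 : state R).
Let n := nmem s0 0 0 0.
Let N i := nmem s0 1 i 0.
Let a i k := rmem s0 1 i k.
Let col i k := nmem s0 2 i k.
Let lam := rmem s0 0 0 0.
Let g := rmem s0 0 0 1.

Definition pl1 i := \sum_(k < N i) `|a i k|.
Definition pl2 i := \sum_(k < N i) a i k ^+ 2.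
Definition pdot i := \sum_(k < N i) a i k * rmem s0 3 (col i k) 0.
Definition pterm i k j := if col i k == j then a i k * pdot i else 0.
(** The partial value of (A^T A x0)_j after [i] whole rows and [k] entries of row [i]. *)
Definition pq i k j :=
  \sum_(i' < i) \sum_(k' < N i') pterm i' k' j + \sum_(k' < k) pterm i k' j.
Definition weight i k := (N i)%:R * `|a i k| / pl1 i.
Definition pfrob := \sum_(i < n) pl2 i.
Definition row_wt i := n%:R * pl2 i / pfrob.
Definition prho_sum := \sum_(i < n) pl1 i ^+ 2
  + Num.sqrt (pfrob / lam) * \sum_(i < n) pl1 i * Num.sqrt (pl2 i).
Definition piters := 100 * 100 * 100 * 100 * pfrob / (lam * (g * g)).

Record pre_rows i (s : state R) : Prop := PreRows {
  pre_n0 : nmem s 0 = nmem s0 0;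
  pre_n1 : nmem s 1 = nmem s0 1;
  pre_n2 : nmem s 2 = nmem s0 2;
  pre_r0 : rmem s 0 = rmem s0 0;
  pre_r1 : rmem s 1 = rmem s0 1;
  pre_r2 : rmem s 2 = rmem s0 2;
  pre_r3 : rmem s 3 = rmem s0 3;
  pre_l1 : forall i', (i' < i)%N -> rmem s 4 i' 0 = pl1 i';
  pre_l2 : forall i', (i' < i)%N -> rmem s 5 i' 0 = pl2 i';
  pre_tab : forall i', (i' < i)%N ->
    table (nmem s 4 i') (nmem s 5 i') (nmem s 6 i' 0) (N i') (weight i');
  pre_frob : rmem s 8 0 0 = \sum_(i' < i) pl2 i';
  pre_sum1 : rmem s 9 0 0 = \sum_(i' < i) pl1 i' ^+ 2;
  pre_sum2 : rmem s 10 0 0 = \sum_(i' < i) pl1 i' * Num.sqrt (pl2 i');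
  pre_w : forall j, rmem s 13 j 0 = 0 }.

(** The arrays that must be left intact as a whole; the slot arrays 4 and 5 are compared on finished
    rows only, since the next row is being written. *)
Definition rows_core (s : state R) :=
  (nmem s 0, nmem s 1, nmem s 2, nmem s 6,
   (rmem s 0, rmem s 1, rmem s 2, rmem s 3),
   (rmem s 4, rmem s 5, rmem s 8, rmem s 9, rmem s 10, rmem s 13)).

Lemma pre_rows_ext i s s' : rows_core s' = rows_core s ->
  (forall i', (i' < i)%N ->
     nmem s' 4 i' = nmem s 4 i' /\ nmem s' 5 i' = nmem s 5 i') ->
  pre_rows i s -> pre_rows i s'.
Proof.
case=> e0 e1 e2 e6 f0 f1 f2 f3 f4 f5 f8 f9 f10 f13 e45 [] *.
split; rewrite ?(e0, e1, e2, e6, f0, f1, f2, f3, f4, f5, f8, f9, f10, f13) //.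
by move=> i' hi; have [-> ->] := e45 i' hi; auto.
Qed.

Hypothesis pl1_gt0 : forall i, (i < n)%N -> 0 < pl1 i.

Lemma weight_ge0 i k : (i < n)%N -> 0 <= weight i k.
Proof. by move=> hi; rewrite divr_ge0 ?mulr_ge0 // ltW // pl1_gt0. Qed.

Lemma sum_weight i : (i < n)%N -> \sum_(k < N i) weight i k = (N i)%:R.
Proof.
move=> hi; rewrite -mulr_suml -mulr_sumr -/(pl1 i) mulfK //.
by rewrite gt_eqF // pl1_gt0.
Qed.

Definition row_sums_inv i k s : Prop :=
  [/\ pre_rows i s, forall j, rmem s 7 j 0 = pq i 0 j,
      nmem s 20 0 0 = i /\ nmem s 21 0 0 = k
    & [/\ rmem s 30 0 0 = \sum_(k' < k) `|a i k'|,
          rmem s 31 0 0 = \sum_(k' < k) a i k' ^+ 2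
        & rmem s 32 0 0 = \sum_(k' < k) a i k' * rmem s0 3 (col i k') 0]].

Definition row_table_inv i k s : Prop :=
  [/\ pre_rows i s, forall j, rmem s 7 j 0 = pq i k j,
      nmem s 20 0 0 = i /\ nmem s 21 0 0 = k,
      [/\ rmem s 30 0 0 = pl1 i, rmem s 31 0 0 = pl2 i
        & rmem s 32 0 0 = pdot i]
    & table (nmem s 4 i) (nmem s 5 i) (nmem s 27 0 0) k (weight i)].

Definition rows_inv i s : Prop :=
  [/\ pre_rows i s, forall j, rmem s 7 j 0 = pq i 0 j & nmem s 20 0 0 = i].

Lemma row_sums_body_spec i k :
  spec phi (row_sums_inv i k) row_sums_body 7 (row_sums_inv i k.+1).
Proof.
apply: (@spec_straight _ _ _ _ row_sums_body) => // s.
move=> [hp hq [hi hk] [h1 h2 h3]]; rewrite /row_sums_body; split.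
- exact: pre_rows_ext hp.
- exact: hq.
- by rewrite /= /upd /= hi hk addn1.
- rewrite /= /upd /= hi hk (pre_r1 hp) (pre_r3 hp) (pre_n2 hp) h1 h2 h3.
  by rewrite !big_ord_recr /= -!expr2 sqrtr_sqr.
Qed.

Lemma row_table_body_spec i k : (i < n)%N -> (k < N i)%N ->
  spec phi (row_table_inv i k) row_table_body (6 * weight i k + 15)
    (row_table_inv i k.+1).
Proof.
move=> lt_i lt_k.
pose P s := [/\ pre_rows i s, forall j, rmem s 7 j 0 = pq i k.+1 j,
      nmem s 20 0 0 = i /\ nmem s 21 0 0 = k,
      [/\ rmem s 30 0 0 = pl1 i, rmem s 31 0 0 = pl2 i
        & rmem s 32 0 0 = pdot i]
    & table (nmem s 4 i) (nmem s 5 i) (nmem s 27 0 0) k (weight i)].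
pose Q s := [/\ pre_rows i s, forall j, rmem s 7 j 0 = pq i k.+1 j,
      nmem s 20 0 0 = i /\ nmem s 21 0 0 = k,
      [/\ rmem s 30 0 0 = pl1 i, rmem s 31 0 0 = pl2 i
        & rmem s 32 0 0 = pdot i]
    & table (nmem s 4 i) (nmem s 5 i) (nmem s 27 0 0) k.+1 (weight i)].
have h1 : spec phi (row_table_inv i k) (RStore 7 (NLoad 2 (nv 20) (nv 21)) (NConst 0)
    (RAdd (RLoad 7 (NLoad 2 (nv 20) (nv 21)) (NConst 0))
       (RMul (RLoad 1 (nv 20) (nv 21)) (rv 32)))) 1 P.
  apply: spec_rstore => s [hp hq [hi hk] [h1 h2 h3] ht]; split=> //.
  - exact: pre_rows_ext hp.
  - move=> j; rewrite /= upd_eq hi hk (pre_n2 hp) (pre_r1 hp) h3 !hq andbT.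
    rewrite {3}/pq big_ord_recr /= addrA -/(pq i k j) /pterm -/(col i k) eq_sym.
    by case: eqP => [->//|_]; rewrite addr0.
have h2 : spec phi P (slots 4 5 (nv 20) (nv 21) entry_weight)
    (6 * weight i k + 11) Q.
  apply: spec_fix => s [hp hq [hi hk] [e1 e2 e3] ht].
  apply: spec_weaken (@slots_spec _ phi 4 5 (nv 20) (nv 21) entry_weight s
    i k (weight i k) _ _ _); rewrite ?lexx //; last exact: weight_ge0.
    move=> s' [[sn sr] h27 h4 h5]; split.
    + apply: pre_rows_ext hp; first by rewrite /rows_core !sn ?sr.
      move=> i' lt_i'; split; apply/funext => u; rewrite ?h4 ?h5;
        by rewrite (ltn_eqF lt_i').
    + by move=> j; rewrite sr.
    + by rewrite !sn.
    + by rewrite !sr.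
    + rewrite h27; apply: tableS ht; first exact: weight_ge0.
      * by move=> u; rewrite h4 eqxx.
      * by move=> k'; rewrite h5 eqxx.
  move=> s' [sn sr]; split; rewrite /= ?sn ?hi ?hk //.
  rewrite !sr // (pre_r1 hp) (pre_n1 hp) e1 -expr2 sqrtr_sqr //.
have h3 : spec phi Q (nst 21 (NAdd (nv 21) (NConst 1))) 1 (row_table_inv i k.+1).
  apply: spec_nstore => s [hp hq [hi hk] he ht]; split=> //.
  - exact: pre_rows_ext hp.
  - by rewrite /= /upd /= hi hk addn1.
by apply: spec_weaken (spec_seq h1 (spec_seq h2 h3)) => //; lra.
Qed.

Lemma row_body_spec i : (i < n)%N ->
  spec phi (rows_inv i) row_body (60 * (N i).+1%:R) (rows_inv i.+1).
Proof.
move=> lt_i.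
have h1 : spec phi (rows_inv i) row_init 7 (row_sums_inv i 0).
  apply: (@spec_straight _ _ _ _ row_init) => // s [hp hq hi]; split=> //.
  - exact: pre_rows_ext hp.
  - by rewrite /= /upd /= !big_ord0.
have h2 : spec phi (row_sums_inv i 0)
    (While (BNLt (nv 21) (NLoad 1 (nv 20) (NConst 0))) row_sums_body)
    (\sum_(k < N i) (7 + 1) + 1) (row_sums_inv i (N i)).
  apply: (@spec_while _ _ (N i) (row_sums_inv i) (fun=> 7)) => [k s _|k _].
    by move=> [hp _ [hi hk] _]; rewrite /= hi hk (pre_n1 hp).
  exact: row_sums_body_spec.
have h3 : spec phi (row_sums_inv i (N i)) row_mid 3 (row_table_inv i 0).
  apply: (@spec_straight _ _ _ _ row_mid) => // s [hp hq [hi _] he]; split=> //.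
  - exact: pre_rows_ext hp.
  - exact: table0.
have h4 : spec phi (row_table_inv i 0)
    (While (BNLt (nv 21) (NLoad 1 (nv 20) (NConst 0))) row_table_body)
    (\sum_(k < N i) (6 * weight i k + 15 + 1) + 1) (row_table_inv i (N i)).
  apply: (@spec_while _ _ (N i) (row_table_inv i)
     (fun k => 6 * weight i k + 15)) => [k s _|k lt_k].
    by move=> [hp _ [hi hk] _ _]; rewrite /= hi hk (pre_n1 hp).
  exact: row_table_body_spec.
have h5 : spec phi (row_table_inv i (N i)) row_end 13 (rows_inv i.+1).
  apply: (@spec_straight _ _ _ _ row_end) => // s [hp hq [hi hk] [e1 e2 e3] ht].
  case: (hp) => n0 n1 n2 r0 r1 r2 r3 l1 l2 tb fr su1 su2 w.
  have -> : effect row_end s = State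
      (upd (upd (nmem s) 6 (nmem s 20 0 0) 0 (nmem s 27 0 0)) 20 0 0
         (nmem s 20 0 0 + 1)%N)
      (upd (upd (upd (upd (upd (rmem s) 4 (nmem s 20 0 0) 0 (rmem s 30 0 0))
         5 (nmem s 20 0 0) 0 (rmem s 31 0 0)) 8 0 0 (rmem s 8 0 0 + rmem s 31 0 0))
         9 0 0 (rmem s 9 0 0 + rmem s 30 0 0 * rmem s 30 0 0))
         10 0 0 (rmem s 10 0 0 + rmem s 30 0 0 * Num.sqrt (rmem s 31 0 0))) by [].
  rewrite hi e1 e2 addn1 fr su1 su2 -expr2.
  split; last 1 first.
  - by [].
  - split; rewrite ?big_ord_recr //=.
    + move=> i'; rewrite ltnS leq_eqVlt => hi'.
      rewrite upd_ne // upd_ne // upd_ne // upd_ne // upd_eq andbT.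
      by case: eqP hi' => [->//|_ /= hi']; apply: l1.
    + move=> i'; rewrite ltnS leq_eqVlt => hi'.
      rewrite upd_ne // upd_ne // upd_ne // upd_eq andbT.
      by case: eqP hi' => [->//|_ /= hi']; apply: l2.
    + move=> i'; rewrite ltnS leq_eqVlt => hi'.
      rewrite (_ : upd _ 20 _ _ _ 6%N i' 0%N =
        if i' == i then nmem s 27 0 0 else nmem s 6 i' 0); last first.
        by rewrite upd_ne // upd_eq andbT.
      by case: eqP hi' => [->//|_ /= hi']; apply: tb.
  - move=> j; transitivity (rmem s 7 j 0); first by [].
    by rewrite hq /pq big_ord0 addr0 big_ord_recr.
apply: spec_weaken (spec_seq h1 (spec_seq h2 (spec_seq h3 (spec_seq h4 h5)))) => //.
(* The weights of a row sum to [N i], so filling its table takes time linear in its number of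
   nonzeros. *)
have -> : \sum_(k < N i) (6 * weight i k + 15 + 1) = 22 * (N i)%:R.
  rewrite !big_split /= -mulr_sumr sum_weight // !sum_const; ring.
rewrite sum_const -[(N i).+1%:R]natr1.
by have : 0 <= (N i)%:R :> R by []; lra.
Qed.

Hypotheses (pfrob_gt0 : 0 < pfrob) (lam_gt0 : 0 < lam).

Lemma pl2_ge0 i : 0 <= pl2 i.
Proof. by apply: sumr_ge0 => k _; exact: sqr_ge0. Qed.

Lemma row_wt_ge0 i : 0 <= row_wt i.
Proof. by rewrite divr_ge0 ?mulr_ge0 ?pl2_ge0 // ltW. Qed.

Lemma sum_row_wt : \sum_(i < n) row_wt i = n%:R.
Proof. by rewrite -mulr_suml -mulr_sumr -/pfrob mulfK // gt_eqF. Qed.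

Lemma piters_ge0 : 0 <= piters.
Proof.
apply: divr_ge0; first by rewrite !mulr_ge0 // ltW.
by apply: mulr_ge0; rewrite ?(ltW lam_gt0) // -expr2 sqr_ge0.
Qed.

Definition rows_table_inv i s : Prop :=
  [/\ pre_rows n s, forall j, rmem s 7 j 0 = pq n 0 j, nmem s 20 0 0 = i
    & table (nmem s 7 0) (nmem s 8 0) (nmem s 27 0 0) i row_wt].

Definition iters_inv t s : Prop :=
  [/\ pre_rows n s, forall j, rmem s 7 j 0 = pq n 0 j, nmem s 22 0 0 = t
    & table (nmem s 7 0) (nmem s 8 0) (nmem s 9 0 0) n row_wt].

Record preprocessed (s : state R) : Prop := Preprocessed {
  post_rows : pre_rows n s;
  post_q : forall j, rmem s 7 j 0 = pq n 0 j;
  post_table : table (nmem s 7 0) (nmem s 8 0) (nmem s 9 0 0) n row_wt;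
  post_eta : rmem s 11 0 0 = g / (100 * 100 * 5 * pfrob);
  post_budget : rmem s 12 0 0 = 4 * (nceil piters)%:R * prho_sum / pfrob;
  post_iters : nmem s 22 0 0 = nceil piters;
  post_beta : rmem s 20 0 0 = 0;
  post_sigma : rmem s 21 0 0 = 1;
  post_spent : rmem s 23 0 0 = 0 }.

Lemma rows_table_body_spec i : (i < n)%N ->
  spec phi (rows_table_inv i) rows_table_body (6 * row_wt i + 13)
    (rows_table_inv i.+1).
Proof.
move=> lt_i.
pose P s := [/\ pre_rows n s, forall j, rmem s 7 j 0 = pq n 0 j, nmem s 20 0 0 = i
    & table (nmem s 7 0) (nmem s 8 0) (nmem s 27 0 0) i.+1 row_wt].
have h1 : spec phi (rows_table_inv i) (slots 7 8 (NConst 0) (nv 20) row_weight)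
    (6 * row_wt i + 11) P.
  apply: spec_fix => s [hp hq hi ht].
  apply: spec_weaken (@slots_spec _ phi 7 8 (NConst 0) (nv 20) row_weight s
    0 i (row_wt i) _ _ _); rewrite ?lexx //; last exact: row_wt_ge0.
    move=> s' [[sn sr] h27 h7 h8]; split.
    + by apply: pre_rows_ext hp => [|i' _]; rewrite /rows_core !sn ?sr.
    + by move=> j; rewrite sr.
    + by rewrite !sn.
    + rewrite h27; apply: tableS ht; first exact: row_wt_ge0.
      * by move=> u; rewrite h7 eqxx.
      * by move=> k'; rewrite h8 eqxx.
  move=> s' [sn sr]; split; rewrite /= ?sn ?hi //.
  by rewrite !sr // (pre_l2 hp) // (pre_frob hp) (pre_n0 hp).
have h2 : spec phi P (nst 20 (NAdd (nv 20) (NConst 1))) 1 (rows_table_inv i.+1).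
  apply: spec_nstore => s [hp hq hi ht]; split=> //.
  - exact: pre_rows_ext hp.
  - by rewrite /= /upd /= hi addn1.
by apply: spec_weaken (spec_seq h1 h2) => //; lra.
Qed.

(** Both kinds of weights average to 1, so all tables together have O(nnz + n) slots; the last term
    is the time for counting up to the number of iterations. *)
Lemma preprocess_spec : spec phi (rows_inv 0) preprocess
  (100 * (\sum_(i < n) (N i)%:R + n%:R + 1) + 2 * (nceil piters)%:R)
  preprocessed.
Proof.
have h1 : spec phi (rows_inv 0) (While (BNLt (nv 20) (nv 0)) row_body)
    (\sum_(i < n) (60 * (N i).+1%:R + 1) + 1) (rows_inv n).
  apply: (@spec_while _ _ n rows_inv (fun i => 60 * (N i).+1%:R)) => [i s _|i].
    by move=> [hp _ hi]; rewrite /= hi (pre_n0 hp).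
  exact: row_body_spec.
have h2 : spec phi (rows_inv n) (nst 20 (NConst 0) ;; nst 27 (NConst 0)) 3
    (rows_table_inv 0).
  apply: (@spec_straight _ _ _ _ (nst 20 (NConst 0) ;; nst 27 (NConst 0))) => //.
  move=> s [hp hq hi]; split=> //; first exact: pre_rows_ext hp.
  exact: table0.
have h3 : spec phi (rows_table_inv 0) (While (BNLt (nv 20) (nv 0)) rows_table_body)
    (\sum_(i < n) (6 * row_wt i + 13 + 1) + 1) (rows_table_inv n).
  apply: (@spec_while _ _ n rows_table_inv (fun i => 6 * row_wt i + 13)) => [i s _|i].
    by move=> [hp _ hi _]; rewrite /= hi (pre_n0 hp).
  exact: rows_table_body_spec.
have h4 : spec phi (rows_table_inv n) (nst 9 (nv 27) ;; nst 22 (NConst 0)) 3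
    (iters_inv 0).
  apply: (@spec_straight _ _ _ _ (nst 9 (nv 27) ;; nst 22 (NConst 0))) => //.
  by move=> s [hp hq hi ht]; split=> //; exact: pre_rows_ext hp.
have h5 : spec phi (iters_inv 0) (While (BRLt (RNat (nv 22)) iterations)
    (nst 22 (NAdd (nv 22) (NConst 1)))) (\sum_(t < nceil piters) (1 + 1) + 1)
    (iters_inv (nceil piters)).
  apply: (@spec_while _ _ (nceil piters) iters_inv (fun=> 1)) => [t s _|t _].
    move=> [hp _ ht _]; rewrite /= ht (pre_frob hp) (pre_r0 hp).
    by rewrite -ltr_nceil // piters_ge0.
  apply: spec_nstore => s [hp hq hi ht]; split=> //.
    exact: pre_rows_ext hp.
  by rewrite /= /upd /= hi addn1.
have h6 : spec phi (iters_inv (nceil piters)) main_init 9 preprocessed.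
  apply: (@spec_straight _ _ _ _ main_init) => // s [hp hq hi ht].
  have -> : effect main_init s = State (nmem s)
      (upd (upd (upd (upd (upd (rmem s) 11 0 0
        (rmem s 0 0 1 / (100 * 100 * 5 * rmem s 8 0 0)))
        12 0 0 (4 * (nmem s 22 0 0)%:R * (rmem s 9 0 0 +
          Num.sqrt (rmem s 8 0 0 / rmem s 0 0 0) * rmem s 10 0 0) / rmem s 8 0 0))
        20 0 0 0) 21 0 0 1) 23 0 0 0) by [].
  rewrite (pre_r0 hp) (pre_frob hp) (pre_sum1 hp) (pre_sum2 hp) hi.
  by split=> //; exact: pre_rows_ext hp.
apply: spec_weaken (spec_seq h1 (spec_seq h2 (spec_seq h3 (spec_seq h4
  (spec_seq h5 h6))))) => //.
have -> : \sum_(i < n) (60 * (N i).+1%:R + 1) =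
    60 * (\sum_(i < n) (N i)%:R) + 61 * n%:R :> R.
  rewrite mulr_sumr [61 * _]mulrC -sum_const -big_split /=.
  by apply: eq_bigr => i _; rewrite -natr1; lra.
have -> : \sum_(i < n) (6 * row_wt i + 13 + 1) = 20 * n%:R.
  by rewrite !big_split /= -mulr_sumr sum_row_wt !sum_const; ring.
rewrite sum_const.
have : 0 <= \sum_(i < n) (N i)%:R :> R by apply: sumr_ge0.
have : 0 <= n%:R :> R by [].
lra.
Qed.

End Preprocess.

(** * The sparse input and the matrix that it represents *)

Section Input.
Variables (R : realType) (n d : nat) (A : 'M[R]_(n, d)).
Variables (lam g : R) (c x0 : 'cV[R]_d).
Let s0 := input A lam g c x0.

Lemma entry_ord (v : 'cV[R]_d) (j : 'I_d) : entry v j = v j 0.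
Proof. by rewrite /entry valK. Qed.

Lemma input_nnz (i : 'I_n) : nmem s0 1 i 0 = size (row_support A i).
Proof. by rewrite /= valK. Qed.

Lemma input_col_lt (i : 'I_n) k : (k < nmem s0 1 i 0)%N -> (nmem s0 2 i k < d)%N.
Proof.
rewrite input_nnz /= valK => hk.
have : nth 0%N [seq val j | j <- row_support A i] k \in [seq val j | j <- row_support A i].
  by rewrite mem_nth // size_map.
by case/mapP => j _ ->; exact: ltn_ord.
Qed.

(** Columns outside the support contribute [G 0 j], which vanishes; this turns sums over stored
    entries into sums over columns. *)
Lemma input_sum (i : 'I_n) (G : R -> nat -> R) : (forall j, G 0 j = 0) ->
  \sum_(k < nmem s0 1 i 0) G (rmem s0 1 i k) (nmem s0 2 i k) =
  \sum_(j < d) G (A i j) j.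
Proof.
move=> G0; rewrite input_nnz.
transitivity (\sum_(j <- row_support A i) G (A i j) j).
  case E: (row_support A i) => [|j0 l]; first by rewrite big_ord0 big_nil.
  rewrite -E (big_nth j0) big_mkord; apply: eq_bigr => k _.
  by rewrite /= valK (nth_map j0) // (nth_map j0).
rewrite big_filter big_enum_cond /= [RHS](bigID (fun j => A i j != 0)) /=.
rewrite [X in _ = _ + X]big1 ?addr0 // => j /negPn/eqP ->; exact: G0.
Qed.

Lemma input_pl1 (i : 'I_n) : pl1 s0 i = rowl1 A i.
Proof. by rewrite /pl1 (@input_sum i (fun x _ => `|x|)) // => _; rewrite normr0. Qed.

Lemma input_pl2 (i : 'I_n) : pl2 s0 i = rowl2 A i.
Proof.
by rewrite /pl2 (@input_sum i (fun x _ => x ^+ 2)) // => _; rewrite expr0n.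
Qed.

Lemma input_pfrob : pfrob s0 = frob2 A.
Proof. by apply: eq_bigr => i _; rewrite input_pl2. Qed.

Lemma input_pdot (i : 'I_n) : pdot s0 i = rowdot A i x0.
Proof.
rewrite /pdot (@input_sum i (fun x j => x * entry x0 j)).
  by apply: eq_bigr => j _; rewrite entry_ord.
by move=> j; rewrite mul0r.
Qed.

Lemma input_pq (j : 'I_d) : pq s0 n 0 j = (A^T *m A *m x0) j 0.
Proof.
rewrite /pq big_ord0 addr0 mulmx_gramE summxE; apply: eq_bigr => i _.
rewrite !mxE (@input_sum i (fun x j' => if j' == j then x * pdot s0 i else 0)).
  rewrite (bigD1 j) //= eqxx big1 ?addr0; first by rewrite input_pdot mulrC.
  by move=> j' /negbTE; rewrite -val_eqE /= => ->.
by move=> j'; rewrite mul0r if_same.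
Qed.

Lemma sum_input_nnz : (\sum_(i < n) nmem s0 1 i 0)%N = nnz A.
Proof.
rewrite /nnz -sum1_card.
transitivity (\sum_(i < n) \sum_(j < d | (A i j != 0)%R) 1)%N.
  apply: eq_bigr => i _; rewrite input_nnz -sum1_size big_filter big_enum_cond /=.
  by [].
rewrite pair_big_dep /=; apply: eq_bigl => ij; by rewrite inE.
Qed.

Lemma input_rows_inv : rows_inv s0 0 s0.
Proof.
split=> //.
- by split=> //; rewrite big_ord0.
- by move=> j; rewrite /pq !big_ord0 addr0.
Qed.

End Input.

(** * The stochastic iteration *)

Section OkLe.
Variables (R : realType) (phi : state R -> R).

(** Like its companions below, it subtracts the cost from the goal, so it applies to a time bound of
    any shape. *)
Lemma ok_seq_le tau c1 c2 k s v :
  ok phi (tau - 1) [:: c1, c2 & k] s v -> ok phi tau (Seq c1 c2 :: k) s v.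
Proof. by move=> h; rewrite -(subrK 1 tau); apply: ok_seq. Qed.

Lemma ok_if_le tau b c1 c2 k s v :
  ok phi (tau - 1) ((if beval s b then c1 else c2) :: k) s v ->
  ok phi tau (If b c1 c2 :: k) s v.
Proof. by move=> h; rewrite -(subrK 1 tau); apply: ok_if. Qed.

Lemma ok_while_le tau b c k s v :
  ok phi (tau - 1) (if beval s b then [:: c, While b c & k] else k) s v ->
  ok phi tau (While b c :: k) s v.
Proof. by move=> h; rewrite -(subrK 1 tau); apply: ok_while. Qed.

Lemma ok_straight_le tau c k s v : straight c ->
  ok phi (tau - (cost c)%:R) k (effect c s) v -> ok phi tau (c :: k) s v.
Proof.
by move=> hc h; rewrite -(subrK (cost c)%:R tau); apply: ok_straight.
Qed.

Lemma ok_unif_le tau a i j e k s (w : nat -> R) v L : 1 <= tau ->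
  (neval s e).+1 = L ->
  (forall x, (x < L)%N -> ok phi (tau - 1) k (nset s a (neval s i) (neval s j) x) (w x)) ->
  L%:R^-1 * \sum_(x < L) w x <= v ->
  ok phi tau (Unif a i j e :: k) s v.
Proof.
move=> tau1 EL hw hv; subst L.
apply: (ok_weaken (ok_unif _ hw) _ hv); first by rewrite subr_ge0.
by rewrite subrK.
Qed.

Lemma ok_flip_le tau a i j e k s (p w1 w0 v : R) :
  reval s e = p -> 0 <= p <= 1 ->
  ok phi (tau - 1) k (nset s a (neval s i) (neval s j) 1) w1 ->
  ok phi (tau - 1) k (nset s a (neval s i) (neval s j) 0) w0 ->
  p * w1 + (1 - p) * w0 <= v ->
  ok phi tau (Flip a i j e :: k) s v.
Proof.
move=> <- hp h1 h0 hv; apply: (ok_weaken (ok_flip hp h1 h0) _ hv).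
by rewrite subrK.
Qed.

End OkLe.

Section Main.
Variables (R : realType) (n d : nat) (A : 'M[R]_(n, d)).
Variables (lam1 lam g : R) (c x0 xs : 'cV[R]_d).
Let s0 := input A lam g c x0.
Let B := lam%:M - A^T *m A.
Let F := frob2 A.
Let vs := xs - x0.
Let phi (s : state R) := sqnorm B (output solver d s - xs).

Hypothesis Bxs : B *m xs = c.
Hypothesis rowl1_gt0 : forall i, 0 < rowl1 A i.
Hypothesis rowl2_gt0 : forall i, 0 < rowl2 A i.
Hypotheses (frob2_gt0 : 0 < F) (lam_gt0 : 0 < lam).

Variable S : state R.
Hypothesis hS : preprocessed s0 S.

(** These arrays are read-only in the main loop; everything it modifies lies above them. *)
Definition framed (s : state R) : Prop :=
  (forall a, (a < 10)%N -> nmem s a = nmem S a) /\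
  (forall a, (a < 13)%N -> rmem s a = rmem S a).

Definition iterate (s : state R) (j : nat) : R :=
  rmem s 20 0 0 * (rmem s 0 0 0 * rmem s 3 j 0 - rmem s 7 j 0 - rmem s 2 j 0)
  + rmem s 21 0 0 * rmem s 13 j 0.
Definition vec (s : state R) : 'cV[R]_d := \col_j iterate s j.
Definition wvec (s : state R) : 'cV[R]_d := \col_j rmem s 13 j 0.

Let hrows : pre_rows s0 n S := post_rows hS.

(** Since c = B x*, the initial gradient B x0 - c equals - B vs. *)
Lemma vecE s : framed s ->
  vec s = rmem s 20 0 0 *: - (B *m vs) + rmem s 21 0 0 *: wvec s.
Proof.
move=> [_ fr].
have -> : - (B *m vs) = lam *: x0 - A^T *m A *m x0 - c.
  by rewrite -mulmxN opprB mulmxBr Bxs {1}/B mulmxBl mul_scalar_mx.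
apply/matrixP => j z; rewrite ord1 {z} [LHS]mxE /iterate.
rewrite (fr 0%N) // (fr 2%N) // (fr 3%N) // (fr 7%N) //.
rewrite (pre_r0 hrows) (pre_r3 hrows) (pre_r2 hrows) (post_q hS) input_pq.
by rewrite /= !entry_ord !mxE.
Qed.

Lemma phiE s : framed s -> phi s = sqnorm B (vec s - vs).
Proof.
move=> [_ fr]; rewrite /phi /vs opprB addrA [vec s + _]addrC; congr sqnorm.
congr (_ - xs); apply/matrixP => j z; rewrite ord1 !mxE /=.
by rewrite /iterate (fr 3%N) // (pre_r3 hrows) /= entry_ord.
Qed.

Lemma framed_nset s a i k v : (10 <= a)%N -> framed s -> framed (nset s a i k v).
Proof.
move=> ha [h1 h2]; split=> // a' ha'; rewrite -h1 //=; apply: upd_ne.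
by rewrite ltn_eqF // (leq_trans ha').
Qed.

Lemma framed_rset s a i k v : (13 <= a)%N -> framed s -> framed (rset s a i k v).
Proof.
move=> ha [h1 h2]; split=> // a' ha'; rewrite -h2 //=; apply: upd_ne.
by rewrite ltn_eqF // (leq_trans ha').
Qed.

(** Indexed by a natural number because column indices are read from memory; it is 0 out of
    range. *)
Definition unitv (j : nat) : 'cV[R]_d := \col_j' (val j' == j)%:R.

Lemma dotp_unitv (y : 'cV[R]_d) j : dotp y (unitv j) = entry y j.
Proof.
rewrite dotpE /entry; case: insubP => [j' _ <-|].
  rewrite (bigD1 j') //= mxE eqxx mulr1 big1 ?addr0 // => k kj.
  by rewrite mxE val_eqE (negbTE kj) mulr0.
rewrite -leqNgt => dj; apply: big1 => k _; rewrite mxE ltn_eqF ?mulr0 //.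
exact: leq_trans (ltn_ord k) dj.
Qed.

Lemma entry_lt (y : 'cV[R]_d) j (hj : (j < d)%N) : entry y j = y (Ordinal hj) 0.
Proof. by rewrite -(entry_ord y (Ordinal hj)). Qed.

Lemma entry_unitv j : (j < d)%N -> entry (unitv j) j = 1.
Proof. by move=> hj; rewrite entry_lt mxE /= eqxx. Qed.

(** * Sampling the entries of a fixed row *)

Section Row.
Variable i : 'I_n.
Let L := nmem S 6 i 0.
Let N := nmem s0 1 i 0.
Let tab u := nmem S 4 i u.
Let cnt k := nmem S 5 i k.
Let cl k := nmem s0 2 i k.
Let a := (row i A)^T.

Definition slotv (k : nat) : R := L%:R * rmem s0 1 i k / (cnt k)%:R.

Let htab : table (nmem S 4 i) (nmem S 5 i) L N (weight s0 i) :=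
  pre_tab hrows (ltn_ord i).

Let pl1_gt0 : forall i', (i' < nmem s0 0 0 0)%N -> 0 < pl1 s0 i'.
Proof.
by move=> i' hi'; rewrite -[i']/(val (Ordinal (hi' : (i' < n)%N))) input_pl1.
Qed.

Lemma row_nnz_gt0 : (0 < N)%N.
Proof.
case E: N => [|//]; have := rowl1_gt0 i; rewrite -(input_pl1 A lam g c x0) /pl1.
by rewrite -/s0 -/N E big_ord0 ltxx.
Qed.

Lemma row_len_ge : N%:R <= L%:R :> R.
Proof.
have := table_sum htab (fun=> 1); rewrite sum_const mulr1 => ->.
rewrite -(sum_weight pl1_gt0 (ltn_ord i)).
by apply: ler_sum => k _; rewrite mulr1; apply: (table_ge htab).
Qed.

Lemma row_len_gt0 : (0 < L)%N.
Proof.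
rewrite -(ltr0n R); apply: lt_le_trans row_len_ge.
by rewrite ltr0n row_nnz_gt0.
Qed.

Lemma row_len_le : L%:R <= 2 * N%:R :> R.
Proof.
apply: le_trans (table_len htab) _.
by rewrite big_split /= (sum_weight pl1_gt0 (ltn_ord i)) sum_const -/s0 -/N; lra.
Qed.

Lemma slot_sum (f : R -> nat -> R) :
  \sum_(u < L) f (slotv (tab u)) (cl (tab u)) =
  \sum_(k < N) (cnt k)%:R * f (slotv k) (cl k).
Proof. exact: (table_sum htab (fun k => f (slotv k) (cl k))). Qed.

(** The slot count bounds the weight from above, so an entry without slots is 0; this settles the
    divisions by zero in [slotv]. *)
Lemma cnt_eq0 k : (k < N)%N -> (cnt k)%:R = 0 :> R -> rmem s0 1 i k = 0.
Proof.
move=> hk E; have := table_ge htab hk; rewrite -/(cnt k) E => h.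
have h0 : weight s0 i k = 0.
  by apply/eqP; rewrite eq_le h weight_ge0 // pl1_gt0.
apply/eqP; rewrite -normr_eq0; move/eqP: h0.
rewrite /weight mulf_eq0 invr_eq0 (gt_eqF (pl1_gt0 (ltn_ord i))) orbF.
by rewrite mulf_eq0 pnatr_eq0 -/s0 -/N gtn_eqF ?row_nnz_gt0.
Qed.

(** Unbiasedness: the probability [cnt k / L] cancels against the scaling in [slotv]. *)
Lemma slot_mean (h : nat -> R) :
  L%:R^-1 * \sum_(u < L) slotv (tab u) * h (cl (tab u)) = \sum_j A i j * h j.
Proof.
rewrite (slot_sum (fun x j => x * h j)).
rewrite -(@input_sum _ _ _ A lam g c x0 i (fun x j => x * h j)); last first.
  by move=> j; rewrite mul0r.
rewrite mulr_sumr; apply: eq_bigr => k _; rewrite /slotv -/s0 -/(cl k).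
have L0 : L%:R != 0 :> R by rewrite pnatr_eq0 gtn_eqF ?row_len_gt0.
have [c0|cn0] := eqVneq ((cnt k)%:R : R) 0.
  by rewrite (cnt_eq0 (ltn_ord k) c0) !(mul0r, mulr0).
by field; apply/andP.
Qed.

(** The exact second moment has coefficients L x^2 / cnt. The bounds L <= 2 N and cnt >= N |x| /
    |a_i|_1 make them at most 2 |a_i|_1 |x|. *)
Lemma slot_second_moment (h : nat -> R) : (forall j, 0 <= h j) ->
  L%:R^-1 * \sum_(u < L) slotv (tab u) ^+ 2 * h (cl (tab u)) <=
  2 * rowl1 A i * \sum_j `|A i j| * h j.
Proof.
move=> h0; rewrite (slot_sum (fun x j => x ^+ 2 * h j)).
rewrite -(@input_sum _ _ _ A lam g c x0 i (fun x j => `|x| * h j)); last first.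
  by move=> j; rewrite normr0 mul0r.
rewrite [leLHS]mulr_sumr [leRHS]mulr_sumr.
apply: ler_sum => k _; rewrite /slotv -/s0 -/(cl k).
have L0 : L%:R != 0 :> R by rewrite pnatr_eq0 gtn_eqF ?row_len_gt0.
have [c0|cn0] := eqVneq ((cnt k)%:R : R) 0.
  by rewrite c0 mul0r mulr0 (cnt_eq0 (ltn_ord k) c0) normr0 mul0r mulr0.
have cp : 0 < (cnt k)%:R :> R by rewrite lt_neqAle eq_sym cn0 ler0n.
set x := rmem s0 1 i k.
have -> : L%:R^-1 * ((cnt k)%:R * ((L%:R * x / (cnt k)%:R) ^+ 2 * h (cl k))) =
    (L%:R * x ^+ 2) / (cnt k)%:R * h (cl k) by field; apply/andP.
rewrite [leRHS]mulrA ler_wpM2r // ler_pdivrMr //.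
have hx : x ^+ 2 = `|x| ^+ 2 by rewrite -normrX ger0_norm // sqr_ge0.
have := table_ge htab (ltn_ord k); rewrite /weight input_pl1 -/s0 -/N -/x.
rewrite ler_pdivrMr // -/(cnt k) => hc.
apply: (@le_trans _ _ (2 * N%:R * `|x| ^+ 2)).
  by rewrite -hx ler_wpM2r ?sqr_ge0 // row_len_le.
have -> : 2 * N%:R * `|x| ^+ 2 = 2 * `|x| * (N%:R * `|x|) by ring.
have -> : 2 * rowl1 A i * `|x| * (cnt k)%:R =
  2 * `|x| * ((cnt k)%:R * rowl1 A i) by ring.
by rewrite ler_wpM2l // mulr_ge0.
Qed.

Lemma sum_entry (y : 'cV[R]_d) : \sum_j A i j * entry y j = rowdot A i y.
Proof. by apply: eq_bigr => j _; rewrite entry_ord. Qed.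

Lemma slot_lt u : (u < L)%N -> (cl (tab u) < d)%N.
Proof. by move=> hu; apply/input_col_lt/(table_lt htab). Qed.

Lemma dotp_rowE (y : 'cV[R]_d) : dotp y a = rowdot A i y.
Proof. by rewrite dotpE; apply: eq_bigr => j _; rewrite !mxE mulrC. Qed.

(** Unbiasedness fixes the cross term, and the second moment with h = 1 bounds the square term. *)
Lemma vec_step_mean (y : 'cV[R]_d) z :
  L%:R^-1 * \sum_(u < L)
    dotp (y + (z * slotv (tab u)) *: unitv (cl (tab u)))
         (y + (z * slotv (tab u)) *: unitv (cl (tab u)))
  <= dotp (y + z *: a) (y + z *: a) + z ^+ 2 * (2 * rowl1 A i ^+ 2).
Proof.
have L0 : L%:R != 0 :> R by rewrite pnatr_eq0 gtn_eqF ?row_len_gt0.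
have -> : \sum_(u < L) dotp (y + (z * slotv (tab u)) *: unitv (cl (tab u)))
         (y + (z * slotv (tab u)) *: unitv (cl (tab u))) =
   \sum_(u < L) (dotp y y + (2 * z * (slotv (tab u) * entry y (cl (tab u)))
      + z ^+ 2 * (slotv (tab u) ^+ 2 * 1))).
  apply: eq_bigr => u _; rewrite dotpDl !dotpDr !dotpZl !dotpZr (dotpC _ y).
  rewrite !dotp_unitv entry_unitv ?slot_lt //; ring.
rewrite !big_split /= sum_const -!mulr_sumr.
have e1 := slot_mean (entry y); rewrite sum_entry in e1.
have e2 := @slot_second_moment (fun=> 1) (fun=> ler01).
have E : \sum_j `|A i j| * 1 = rowl1 A i by apply: eq_bigr => j _; rewrite mulr1.
rewrite E in e2.
rewrite dotpDl !dotpDr !dotpZl !dotpZr (dotpC a) dotp_rowE -e1 !mulrDr mulKf //.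
have : 0 <= z * (z * dotp a a).
  by rewrite mulrA -expr2 mulr_ge0 ?sqr_ge0 ?dotp_ge0.
have : z ^+ 2 * (L%:R^-1 * \sum_(u < L) slotv (tab u) ^+ 2 * 1) <=
   z ^+ 2 * (2 * rowl1 A i * rowl1 A i) by rewrite ler_wpM2l ?sqr_ge0.
set X1 := \sum_(u < L) _; set X2 := \sum_(u < L) _; move=> h1 h2.
have -> : L%:R^-1 * (2 * z * X2) = 2 * (z * (L%:R^-1 * X2)) by ring.
have -> : L%:R^-1 * (z ^+ 2 * X1) = z ^+ 2 * (L%:R^-1 * X1) by ring.
rewrite -mulrA -expr2 in h1; lra.
Qed.

(** Quadratic polynomials in the running sum are needed because the value after the sampling loop is
    one. *)
Lemma dot_step_mean (v : 'cV[R]_d) p0 p1 p2 D : 0 <= p2 ->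
  L%:R^-1 * \sum_(u < L)
    (p0 + p1 * (D + slotv (tab u) * entry v (cl (tab u)))
        + p2 * (D + slotv (tab u) * entry v (cl (tab u))) ^+ 2)
  <= p0 + p1 * (D + rowdot A i v) + p2 * (D + rowdot A i v) ^+ 2
     + p2 * (2 * rowl1 A i * roww A i v).
Proof.
move=> p20.
have L0 : L%:R != 0 :> R by rewrite pnatr_eq0 gtn_eqF ?row_len_gt0.
have -> : \sum_(u < L) (p0 + p1 * (D + slotv (tab u) * entry v (cl (tab u)))
        + p2 * (D + slotv (tab u) * entry v (cl (tab u))) ^+ 2) =
  \sum_(u < L) ((p0 + p1 * D + p2 * D ^+ 2) +
     ((p1 + 2 * p2 * D) * (slotv (tab u) * entry v (cl (tab u)))
      + p2 * (slotv (tab u) ^+ 2 * entry v (cl (tab u)) ^+ 2))).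
  by apply: eq_bigr => u _; ring.
rewrite big_split /= sum_const big_split /= -!mulr_sumr.
have e1 := slot_mean (entry v); rewrite sum_entry in e1.
have e2 := @slot_second_moment (fun j => entry v j ^+ 2) (fun j => sqr_ge0 _).
have E : \sum_j `|A i j| * entry v j ^+ 2 = roww A i v.
  by apply: eq_bigr => j _; rewrite entry_ord.
rewrite E in e2; rewrite [leLHS]mulrDr mulKf // [L%:R^-1 * (_ + _)]mulrDr.
have h1 : p2 * (L%:R^-1 * \sum_(u < L) slotv (tab u) ^+ 2 * entry v (cl (tab u)) ^+ 2)
   <= p2 * (2 * rowl1 A i * roww A i v) by rewrite ler_wpM2l.
move: h1 e1; set X1 := \sum_(u < L) _; set X2 := \sum_(u < L) _ => h1 <-.
have -> : L%:R^-1 * ((p1 + 2 * p2 * D) * X2) = (p1 + 2 * p2 * D) * (L%:R^-1 * X2) by ring.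
have -> : L%:R^-1 * (p2 * X1) = p2 * (L%:R^-1 * X1) by ring.
have : 0 <= p2 * (L%:R^-1 * X2) ^+ 2 by rewrite mulr_ge0 ?sqr_ge0.
set t := L%:R^-1 * X2; set t1 := L%:R^-1 * X1 in h1 *; move=> h2.
have E2 : p2 * (D + t) ^+ 2 = p2 * D ^+ 2 + 2 * p2 * D * t + p2 * t ^+ 2 by ring.
lra.
Qed.

End Row.

Lemma mean_affine (L : nat) (a0 b k : R) (f : nat -> R) : (0 < L)%N ->
  L%:R^-1 * \sum_(u < L) (a0 + b * (f u + k)) =
  a0 + b * (L%:R^-1 * \sum_(u < L) f u + k).
Proof.
move=> L0; have Ln0 : L%:R != 0 :> R by rewrite pnatr_eq0 -lt0n.
rewrite big_split /= sum_const -mulr_sumr big_split /= sum_const; by field.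
Qed.

(** The parameters are the remaining iterations, the coefficients beta and sigma of the iterate, and
    the budget spent. *)
Definition dyn (m : nat) (be si sp : R) (s : state R) : Prop :=
  [/\ framed s, nmem s 22 0 0 = m
    & [/\ rmem s 20 0 0 = be, rmem s 21 0 0 = si & rmem s 23 0 0 = sp]].

(** Induction on the samples left: each contributes its mean z a_i and at most 2 z^2 |a_i|_1^2 of
    second moment, where z = sigma times the stored coefficient. *)
Lemma vec_loop (i : 'I_n) r K tau a0 b m be si sp cf : 0 <= tau -> 0 <= b ->
  (forall s', dyn m be si sp s' ->
     ok phi tau K s' (a0 + b * dotp (vec s' - vs) (vec s' - vs))) ->
  forall h s, dyn m be si sp s -> nmem s 20 0 0 = i -> nmem s 25 0 0 = r ->
  (nmem s 26 0 0 + h)%N = r -> rmem s 25 0 0 = cf ->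
  ok phi (tau + (8 * h%:R + 1)) (While (BNLt (nv 26) (nv 25)) vec_body :: K) s
    (a0 + b * (dotp (vec s - vs + (h%:R * (si * cf)) *: (row i A)^T)
                    (vec s - vs + (h%:R * (si * cf)) *: (row i A)^T)
               + h%:R * ((si * cf) ^+ 2 * (2 * rowl1 A i ^+ 2)))).
Proof.
move=> tau0 b0 hK; elim=> [|h IH] s ds hi h25 h26 hcf.
  apply: ok_while_le; rewrite /= h25 -h26 addn0 ltnn.
  by apply: ok_weaken (hK _ ds) _ _; rewrite ?mul0r ?scale0r ?addr0 //; lra.
have h0 : 0 <= h%:R :> R by [].
apply: ok_while_le; rewrite [beval _ _]/= ifT; last by rewrite h25; lia.
rewrite {1}/vec_body; apply: ok_seq_le.
(* In [y] the [h] later samples are replaced by their mean; only the current one is still random. *)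
set z := si * cf; set y := vec s - vs + (h%:R * z) *: (row i A)^T.
have [fs hm [hbe hsi hsp]] := ds; have [fn fr] := fs.
pose k u := nmem S 4 i u; pose cl u := nmem s0 2 i (k u).
apply: (@ok_unif_le _ _ _ _ _ _ _ _ _ (fun u => a0 + b * (dotp
  (y + (z * slotv i (k u)) *: unitv (cl u)) (y + (z * slotv i (k u)) *: unitv (cl u))
  + h%:R * (z ^+ 2 * (2 * rowl1 A i ^+ 2)))) _ (nmem S 6 i 0)).
- by rewrite -[h.+1%:R]natr1; lra.
- by rewrite /= hi (fn 6%N) // subn1 prednK // row_len_gt0.
- move=> u hu; apply: ok_straight_le => //.
  set s' := effect _ _.
  have Es' : s' = State
      (upd (upd (upd (nmem s) 23 0 0 u) 21 0 0 (nmem s 4 (nmem s 20 0 0) u))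
        26 0 0 (nmem s 26 0 0 + 1)%N)
      (upd (rmem s) 13 (nmem s 2 (nmem s 20 0 0) (nmem s 4 (nmem s 20 0 0) u)) 0
        (rmem s 13 (nmem s 2 (nmem s 20 0 0) (nmem s 4 (nmem s 20 0 0) u)) 0 +
         rmem s 25 0 0 * ((nmem s 6 (nmem s 20 0 0) 0)%:R *
           rmem s 1 (nmem s 20 0 0) (nmem s 4 (nmem s 20 0 0) u) /
           (nmem s 5 (nmem s 20 0 0) (nmem s 4 (nmem s 20 0 0) u))%:R))) by [].
  move: Es'; rewrite hi (fn 4%N) // (fn 5%N) // (fn 6%N) // (fn 2%N) // (fr 1%N) //.
  rewrite (pre_n2 hrows) (pre_r1 hrows) hcf -/(k u) -/(cl u) -/(slotv i (k u)).
  clearbody s' => Es'.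
  have fs' : framed s'.
    rewrite Es'; apply: (@framed_rset (State _ (rmem s)) 13) => //.
    apply: (@framed_nset (State _ _) 26) => //.
    apply: (@framed_nset (State _ _) 21) => //.
    exact: (@framed_nset s 23).
  have ds' : dyn m be si sp s' by split=> //; rewrite Es'.
  have Ev : vec s' = vec s + (z * slotv i (k u)) *: unitv (cl u).
    rewrite !vecE // [rmem s' 20 0 0](_ : _ = be); last by case: ds' => _ _ [].
    rewrite [rmem s' 21 0 0](_ : _ = si); last by case: ds' => _ _ [].
    rewrite hbe hsi -addrA; congr (_ + _).
    have -> : wvec s' = wvec s + (cf * slotv i (k u)) *: unitv (cl u).
      apply/matrixP => j t; rewrite ord1 Es' !mxE /= upd_eq andbT.
      by case: eqP => [->|_]; rewrite ?mulr1 ?mulr0 ?addr0.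
    by rewrite scalerDr scalerA mulrA.
  have i' : nmem s' 20 0 0 = i by rewrite Es'.
  have h25' : nmem s' 25 0 0 = r by rewrite Es'.
  have h26' : (nmem s' 26 0 0 + h)%N = r by rewrite Es' /= /upd /= -h26 addn1 addSnnS.
  have hcf' : rmem s' 25 0 0 = cf by rewrite Es'.
  apply: ok_weaken (IH s' ds' i' h25' h26' hcf') _ _.
  + by rewrite -[h.+1%:R]natr1 /=; lra.
  + rewrite Ev -/z [vec s + _ - vs]addrAC /y [_ + _ *: unitv _ + _]addrAC.
    by rewrite lexx.
- rewrite (mean_affine _ _ _
    (fun u => dotp (y + (z * slotv i (k u)) *: unitv (cl u))
                   (y + (z * slotv i (k u)) *: unitv (cl u)))) ?row_len_gt0 //.
  rewrite lerD2l ler_wpM2l //.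
  have := vec_step_mean i y z.
  have -> : y + z *: (row i A)^T = vec s - vs + (h.+1%:R * z) *: (row i A)^T.
    by rewrite /y -addrA -scalerDl -[h.+1%:R]natr1 mulrDl mul1r.
  set q := dotp _ _.
  by clearbody q; rewrite -[h.+1%:R]natr1; lra.
Qed.

Definition rho (i : 'I_n) : R :=
  rowl1 A i * rowl1 A i / rowl2 A i
  + rowl1 A i / Num.sqrt (rowl2 A i) * Num.sqrt (F / lam).

Lemma rho_ge0 i : 0 <= rho i.
Proof.
apply: addr_ge0; first by rewrite divr_ge0 ?mulr_ge0 // ltW.
by rewrite mulr_ge0 ?sqrtr_ge0 // divr_ge0 ?sqrtr_ge0 // ltW.
Qed.

Lemma samples_neededE (i : 'I_n) s : framed s -> nmem s 20 0 0 = i ->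
  reval s samples_needed = rho i.
Proof.
move=> [fn fr] hi; rewrite /= hi !fr // (pre_l1 hrows) ?ltn_ord //.
rewrite (pre_l2 hrows) ?ltn_ord // (pre_frob hrows) (pre_r0 hrows).
by rewrite input_pl1 input_pl2 -[\sum_(_ < _) _]/(pfrob s0) input_pfrob.
Qed.

(** Same induction for the inner product. The guard compares a counter with the real number [rho i],
    so the loop makes [nceil (rho i)] rounds. *)
Lemma dot_loop (i : 'I_n) K tau p0 p1 p2 m be si sp wf v : 0 <= tau -> 0 <= p2 ->
  (forall s', dyn m be si sp s' -> nmem s' 20 0 0 = i ->
     nmem s' 25 0 0 = nceil (rho i) -> nmem s' 26 0 0 = 0%N -> rmem s' 13 = wf ->
     ok phi tau K s' (p0 + p1 * rmem s' 24 0 0 + p2 * rmem s' 24 0 0 ^+ 2)) ->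
  forall h s, dyn m be si sp s -> nmem s 20 0 0 = i -> nmem s 26 0 0 = 0%N ->
  rmem s 13 = wf -> (nmem s 25 0 0 + h)%N = nceil (rho i) -> vec s = v ->
  ok phi (tau + (8 * h%:R + 1))
    (While (BRLt (RNat (nv 25)) samples_needed) dot_body :: K) s
    (p0 + p1 * (rmem s 24 0 0 + h%:R * rowdot A i v)
     + p2 * (rmem s 24 0 0 + h%:R * rowdot A i v) ^+ 2
     + h%:R * (p2 * (2 * rowl1 A i * roww A i v))).
Proof.
move=> tau0 p20 hK; elim=> [|h IH] s ds hi h26 hw h25 hv.
  have [fs _ _] := ds.
  apply: ok_while_le; rewrite [beval _ _]/= -[X in _ < X]/(reval s samples_needed).
  rewrite (samples_neededE fs hi) ltr_nceil ?rho_ge0 // -h25 addn0 ltnn.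
  apply: ok_weaken (hK _ ds _ _ _ _) _ _ => //; first by rewrite -h25 addn0.
    lra.
  by rewrite !mul0r !addr0.
have h0 : 0 <= h%:R :> R by [].
have [fs hm [hbe hsi hsp]] := ds; have [fn fr] := fs.
apply: ok_while_le; rewrite [beval _ _]/= -[X in _ < X]/(reval s samples_needed).
rewrite (samples_neededE fs hi) ltr_nceil ?rho_ge0 // -h25 -addSnnS leq_addr.
rewrite {1}/dot_body; apply: ok_seq_le.
set D := rmem s 24 0 0; set e := rowdot A i v.
pose k u := nmem S 4 i u; pose cl u := nmem s0 2 i (k u).
apply: (@ok_unif_le _ _ _ _ _ _ _ _ _ (fun u =>
   (p0 + p1 * (D + h%:R * e + slotv i (k u) * entry v (cl u))
     + p2 * (D + h%:R * e + slotv i (k u) * entry v (cl u)) ^+ 2)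
     + h%:R * (p2 * (2 * rowl1 A i * roww A i v))) _ (nmem S 6 i 0)).
- by rewrite -[h.+1%:R]natr1; lra.
- by rewrite /= hi (fn 6%N) // subn1 prednK // row_len_gt0.
- move=> u hu; apply: ok_straight_le => //.
  set s' := effect _ _.
  have Es' : s' = State
      (upd (upd (upd (nmem s) 23 0 0 u) 21 0 0 (nmem s 4 (nmem s 20 0 0) u))
        25 0 0 (nmem s 25 0 0 + 1)%N)
      (upd (rmem s) 24 0 0
        (rmem s 24 0 0 + ((nmem s 6 (nmem s 20 0 0) 0)%:R *
           rmem s 1 (nmem s 20 0 0) (nmem s 4 (nmem s 20 0 0) u) /
           (nmem s 5 (nmem s 20 0 0) (nmem s 4 (nmem s 20 0 0) u))%:R) *
           iterate s (nmem s 2 (nmem s 20 0 0) (nmem s 4 (nmem s 20 0 0) u)))) by [].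
  move: Es'; rewrite hi (fn 4%N) // (fn 5%N) // (fn 6%N) // (fn 2%N) // (fr 1%N) //.
  rewrite (pre_n2 hrows) (pre_r1 hrows) -/D -/(k u) -/(cl u) -/(slotv i (k u)).
  have -> : iterate s (cl u) = entry v (cl u).
    by rewrite -hv (entry_lt _ (slot_lt hu)) mxE.
  clearbody s' => Es'.
  have fs' : framed s'.
    rewrite Es'; apply: (@framed_rset (State _ (rmem s)) 24) => //.
    apply: (@framed_nset (State _ _) 25) => //.
    apply: (@framed_nset (State _ _) 21) => //.
    exact: (@framed_nset s 23).
  have ds' : dyn m be si sp s' by split=> //; rewrite Es'.
  have i' : nmem s' 20 0 0 = i by rewrite Es'.
  have h26' : nmem s' 26 0 0 = 0%N by rewrite Es'.
  have hw' : rmem s' 13 = wf by rewrite Es'.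
  have h25' : (nmem s' 25 0 0 + h)%N = nceil (rho i).
    by rewrite Es' /= /upd /= -h25 addn1 addSnnS.
  have hv' : vec s' = v by rewrite -hv Es'.
  apply: ok_weaken (IH s' ds' i' h26' hw' h25' hv') _ _.
  + by rewrite -[h.+1%:R]natr1 /=; lra.
  + rewrite Es' /= /upd /= -/D -/e.
    by rewrite [D + h%:R * e + _]addrAC lexx.
- rewrite big_split /= sum_const mulrDr mulKf; last first.
    by rewrite pnatr_eq0 -lt0n row_len_gt0.
  have := dot_step_mean i v p0 p1 (D + h%:R * e) p20.
  have -> : D + h%:R * e + rowdot A i v = D + h.+1%:R * e.
    by rewrite -[h.+1%:R]natr1 /e; ring.
  by set q := D + _; clearbody q; rewrite -[h.+1%:R]natr1; lra.
Qed.

Let eta := g / (100 * 100 * 5 * F).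
Let rlen := nmem S 9 0 0.
(** The probability that row i is drawn and then accepted. *)
Definition rowq (i : 'I_n) : R := n%:R * rowl2 A i / (F * rlen%:R).
Definition nsamples (i : 'I_n) : R := (nceil (rho i))%:R.

Hypothesis eta_lam : eta * lam < 1.
Hypothesis eta_gt0 : 0 < eta.

Lemma mem_eta s : framed s -> rmem s 11 0 0 = eta.
Proof. by move=> [_ fr]; rewrite fr // (post_eta hS) input_pfrob. Qed.

Lemma mem_lam s : framed s -> rmem s 0 0 0 = lam.
Proof. by move=> [_ fr]; rewrite fr // (pre_r0 hrows). Qed.

Lemma mem_frob s : framed s -> rmem s 8 0 0 = F.
Proof.
move=> [_ fr]; rewrite fr // (pre_frob hrows).
by rewrite -[\sum_(_ < _) _]/(pfrob s0) input_pfrob.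
Qed.

Lemma mem_l2 (i : 'I_n) s : framed s -> rmem s 5 i 0 = rowl2 A i.
Proof. by move=> [_ fr]; rewrite fr // (pre_l2 hrows) ?ltn_ord // input_pl2. Qed.

Lemma mem_n s : framed s -> nmem s 0 0 0 = n.
Proof. by move=> [fn _]; rewrite fn // (pre_n0 hrows). Qed.

Lemma decay_vec s s' : framed s -> framed s' ->
  rmem s' 20 0 0 = (1 - eta * lam) * rmem s 20 0 0 - eta ->
  rmem s' 21 0 0 = (1 - eta * lam) * rmem s 21 0 0 -> rmem s' 13 = rmem s 13 ->
  vec s' = (1 - eta * lam) *: vec s + eta *: (B *m vs).
Proof.
move=> fs fs' e20 e21 e13; rewrite !vecE // e20 e21.
have -> : wvec s' = wvec s by apply/matrixP => j z; rewrite !mxE e13.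
rewrite scalerDr !scalerA scalerBl -!addrA; congr (_ + _).
by rewrite scalerN opprK addrC.
Qed.

Lemma rlen_ge : n%:R <= rlen%:R :> R.
Proof.
have := table_sum (post_table hS) (fun=> 1); rewrite sum_const mulr1 => ->.
rewrite -[X in X%:R <= _]/(nmem s0 0 0 0) -(@sum_row_wt _ s0) ?input_pfrob //.
by apply: ler_sum => k _; rewrite mulr1; apply: (table_ge (post_table hS)).
Qed.

Lemma rlen_le : rlen%:R <= 2 * n%:R :> R.
Proof.
apply: le_trans (table_len (post_table hS)) _.
rewrite big_split /= (@sum_row_wt _ s0) ?input_pfrob // sum_const mulr1.
by rewrite /=; lra.
Qed.

Lemma n_gt0 : (0 < n)%N.
Proof.
rewrite lt0n; apply/eqP => n0; move: frob2_gt0; rewrite /F /frob2.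
by rewrite big1 ?ltxx // => i; have := ltn_ord i; rewrite {2}n0.
Qed.

Lemma rlen_gt0 : (0 < rlen)%N.
Proof. by rewrite -(ltr0n R); apply: lt_le_trans rlen_ge; rewrite ltr0n n_gt0. Qed.

Lemma rho_gt0 i : 0 < rho i.
Proof.
apply: ltr_pwDl; first by rewrite divr_gt0 ?mulr_gt0.
by rewrite mulr_ge0 ?sqrtr_ge0 // divr_ge0 ?sqrtr_ge0 // ltW.
Qed.

Lemma nsamples_gt0 i : 0 < nsamples i.
Proof. exact: lt_le_trans (rho_gt0 i) (ler_nceil (rho_ge0 i)). Qed.

Lemma rowq_gt0 i : 0 < rowq i.
Proof.
by rewrite divr_gt0 // mulr_gt0 // ltr0n ?n_gt0 ?rlen_gt0.
Qed.

(** The loops are treated backwards: [vec_loop] leaves a quadratic polynomial in the sum D of the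
    inner product samples, which [dot_loop] then averages. *)
Lemma row_update_ok (i : 'I_n) K tau a0 b m be si sp s : 0 <= tau -> 0 <= b ->
  si != 0 ->
  (forall s', dyn m ((1 - eta * lam) * be - eta) ((1 - eta * lam) * si)
      (sp + rho i) s' ->
     ok phi tau K s' (a0 + b * dotp (vec s' - vs) (vec s' - vs))) ->
  dyn m be si sp s -> nmem s 20 0 0 = i ->
  ok phi (tau + 16 * nsamples i + 30) (row_update :: K) s
    (a0 + b * row_moment A nsamples rowq (vec s) eta
      ((1 - eta * lam) *: vec s + eta *: (B *m vs) - vs) i).
Proof.
move=> tau0 b0 si0 hK ds hi.
have [fs hm [hbe hsi hsp]] := ds.
set v := vec s; set y0 := _ - vs; set r := nsamples i.
have r0 : 0 < r := nsamples_gt0 i.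
set k := eta / rowq i.
(* The coefficients of that polynomial in D, obtained from [vec_loop] with z = k D / r^2 and r
   samples. *)
set p0 := a0 + b * dotp y0 y0.
set p1 := b * (2 * (k / r)) * dotp y0 (row i A)^T.
set p2 := b * k ^+ 2 * ((rowl2 A i + 2 * rowl1 A i ^+ 2 / r) / r ^+ 2).
have p20 : 0 <= p2.
  apply: mulr_ge0; first by apply: mulr_ge0 => //; exact: sqr_ge0.
  apply: divr_ge0; last exact: sqr_ge0.
  apply: addr_ge0; first exact: ltW.
  by apply: divr_ge0; [apply: mulr_ge0 => //; exact: sqr_ge0|exact: ltW].
rewrite {1}/row_update; apply: ok_seq_le; apply: ok_straight_le => //.
set s1 := effect _ _.
have Es1 : s1 = State (upd (upd (nmem s) 25 0 0 0%N) 26 0 0 0%N)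
   (upd (upd (rmem s) 23 0 0 (rmem s 23 0 0 + reval s samples_needed)) 24 0 0 0).
  by [].
rewrite (samples_neededE fs hi) hsp in Es1; clearbody s1.
have fs1 : framed s1.
  rewrite Es1; apply: (@framed_rset (State _ _) 24) => //.
  apply: (@framed_rset (State _ _) 23) => //.
  apply: (@framed_nset (State _ _) 26) => //; exact: (@framed_nset s 25).
have ds1 : dyn m be si (sp + rho i) s1 by split=> //; rewrite Es1.
apply: ok_seq_le.
have hi1 : nmem s1 20 0 0 = i by rewrite Es1.
have h26 : nmem s1 26 0 0 = 0%N by rewrite Es1.
have hw : rmem s1 13 = rmem s 13 by rewrite Es1.
have h25 : (nmem s1 25 0 0 + nceil (rho i))%N = nceil (rho i) by rewrite Es1.
have hv : vec s1 = v by rewrite Es1.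
have hD : rmem s1 24 0 0 = 0 by rewrite Es1.
have T1 : 0 <= tau + (8 * r + 1) + 6 by have := ltW r0; lra.
apply: ok_weaken (@dot_loop i _ (tau + (8 * r + 1) + 6) p0 p1 p2 m be si
   (sp + rho i) _ v T1 p20 _ _ _ ds1 hi1 h26 hw h25 hv) _ _.
- move=> s2 ds2 hi2 h25' h26' hw2.
  have [fs2 hm2 [hbe2 hsi2 hsp2]] := ds2.
  apply: ok_seq_le; apply: ok_straight_le => //.
  set D := rmem s2 24 0 0.
  set s3 := effect _ _.
  have Es3 : s3 = State (nmem s2)
     (upd (upd (upd (rmem s2) 20 0 0 ((1 - rmem s2 11 0 0 * rmem s2 0 0 0) *
          rmem s2 20 0 0 - rmem s2 11 0 0))
        21 0 0 ((1 - rmem s2 11 0 0 * rmem s2 0 0 0) * rmem s2 21 0 0))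
        25 0 0 (rmem s2 11 0 0 * rmem s2 8 0 0 * (nmem s2 9 0 0)%:R * D /
          ((nmem s2 0 0 0)%:R * rmem s2 5 (nmem s2 20 0 0) 0 *
           (nmem s2 25 0 0)%:R * (nmem s2 25 0 0)%:R *
           ((1 - rmem s2 11 0 0 * rmem s2 0 0 0) * rmem s2 21 0 0)))) by [].
  have h9 : nmem s2 9 0 0 = rlen by case: fs2 => fn _; rewrite fn.
  rewrite h9 hi2 (mem_eta fs2) (mem_lam fs2) (mem_frob fs2) (mem_n fs2) in Es3.
  rewrite (mem_l2 i fs2) h25' -/(nsamples i) -/r hbe2 hsi2 in Es3.
  set cf := _ / _ in Es3.
  clearbody s3.
  have fs3 : framed s3.
    rewrite Es3; apply: (@framed_rset (State _ _) 25) => //.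
    apply: (@framed_rset (State _ _) 21) => //; exact: (@framed_rset s2 20).
  have ds3 : dyn m ((1 - eta * lam) * be - eta) ((1 - eta * lam) * si)
     (sp + rho i) s3 by split=> //; rewrite Es3.
  have Ev : vec s3 = (1 - eta * lam) *: v + eta *: (B *m vs).
    rewrite -hv; apply: decay_vec => //; rewrite Es3 ?hw2 //=.
    + by rewrite /upd /= Es1 /= /upd /= hbe.
    + by rewrite /upd /= Es1 /= /upd /= hsi.
    + exact: etrans hw2 (esym hw).
  have hi3 : nmem s3 20 0 0 = i by rewrite Es3.
  have h25'' : nmem s3 25 0 0 = nceil (rho i) by rewrite Es3.
  have h26'' : (nmem s3 26 0 0 + nceil (rho i))%N = nceil (rho i).
    by rewrite Es3 /= h26'.
  have hcf : rmem s3 25 0 0 = cf by rewrite Es3.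
  apply: ok_weaken (@vec_loop i _ K tau a0 b m _ _ _ cf tau0 b0 hK _ _ ds3 hi3
     h25'' h26'' hcf) _ _.
    by rewrite -/(nsamples i) -/r /=; lra.
  rewrite Ev -/y0 -/(nsamples i) -/r.
  have dec0 : 1 - eta * lam != 0 by rewrite subr_eq0 gt_eqF.
  have n0 : n%:R != 0 :> R by rewrite pnatr_eq0 -lt0n n_gt0.
  have rl0 : rlen%:R != 0 :> R by rewrite pnatr_eq0 -lt0n rlen_gt0.
  have l20 : rowl2 A i != 0 by rewrite gt_eqF.
  have F0 : F != 0 by rewrite gt_eqF.
  have rn0 : r != 0 by rewrite gt_eqF.
  have Ez : (1 - eta * lam) * si * cf = k * D / r ^+ 2.
    rewrite /cf /k /rowq; field.
    by rewrite rn0 l20 n0 rl0 F0 dec0 si0.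
  rewrite Ez; clearbody y0 k.
  rewrite dotpDl !dotpDr !dotpZl !dotpZr (dotpC _ y0) dotp_row.
  rewrite le_eqVlt; apply/orP; left; apply/eqP; rewrite /p0 /p1 /p2.
  by field.
- by rewrite -/(nsamples i) -/r /=; lra.
- rewrite hD !add0r -/(nsamples i) -/r /row_moment -/k -/v -/r.
  have rn0 : r != 0 by rewrite gt_eqF.
  clearbody y0 k; rewrite dotpDl !dotpDr !dotpZl !dotpZr (dotpC _ y0) dotp_row.
  rewrite le_eqVlt; apply/orP; left; apply/eqP; rewrite /p0 /p1 /p2.
  by field.
Qed.

Hypothesis gram_le : forall x, dotp (A *m x) (A *m x) <= lam1 * dotp x x.
Hypotheses (lam1_gt0 : 0 < lam1) (lam1_le : lam1 <= lam).
Hypotheses (g_gt0 : 0 < g) (mu_ge : lam * g / 152 <= lam - lam1).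
Hypothesis frob_lam : lam * g <= 2 * F.

(** Bounds the expected budget charged per iteration. *)
Definition rbar : R := (\sum_i rowl2 A i * rho i) / F.
Let Bud := rmem S 12 0 0.
Let E0 := sqnorm B vs.
Hypothesis Bud_gt0 : 0 < Bud.

Lemma E0_ge0 : 0 <= E0.
Proof.
apply: le_trans (sqnormB_ge lam gram_le vs).
by rewrite mulr_ge0 ?dotp_ge0 // subr_ge0.
Qed.

Lemma rowq_le i : rowq i <= rowl2 A i / F.
Proof.
have -> : rowq i = rowl2 A i / F * (n%:R / rlen%:R).
  by rewrite /rowq invfM; ring.
rewrite ler_piMr ?divr_ge0 ?(ltW (rowl2_gt0 i)) ?(ltW frob2_gt0) //.
by rewrite ler_pdivrMr ?ltr0n ?rlen_gt0 // mul1r rlen_ge.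
Qed.

Lemma sum_rowq_rho : \sum_i rowq i * rho i <= rbar.
Proof.
rewrite /rbar mulr_suml; apply: ler_sum => i _; rewrite [leRHS]mulrAC.
by rewrite ler_wpM2r ?rho_ge0 ?rowq_le.
Qed.

(** The first summand of [rho i] is s_i. *)
Lemma nsamples_sparse i : rowl1 A i ^+ 2 <= rowl2 A i * nsamples i.
Proof.
apply: (@le_trans _ _ (rowl2 A i * rho i)); last first.
  by rewrite ler_pM2l // ler_nceil // rho_ge0.
have l20 : rowl2 A i != 0 by rewrite gt_eqF.
rewrite /rho mulrDr mulrCA divff // mulr1 -expr2 lerDl.
by rewrite mulr_ge0 ?(ltW (rowl2_gt0 i)) // mulr_ge0 ?sqrtr_ge0 // divr_ge0 ?sqrtr_ge0 // ltW.
Qed.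

(** The second summand of [rho i] is sqrt s_i sqrt (F / lam). *)
Lemma nsamples_frob i :
  rowl1 A i * Num.sqrt F <= Num.sqrt (rowl2 A i) * Num.sqrt lam * nsamples i.
Proof.
have sl2 : 0 < Num.sqrt (rowl2 A i) by rewrite sqrtr_gt0.
have sl : 0 < Num.sqrt lam by rewrite sqrtr_gt0.
apply: (@le_trans _ _ (Num.sqrt (rowl2 A i) * Num.sqrt lam * rho i)); last first.
  by rewrite ler_pM2l ?mulr_gt0 // ler_nceil // rho_ge0.
have -> : rowl1 A i * Num.sqrt F = Num.sqrt (rowl2 A i) * Num.sqrt lam *
   (rowl1 A i / Num.sqrt (rowl2 A i) * Num.sqrt (F / lam)).
  rewrite sqrtrM ?sqrtrV ?(ltW frob2_gt0) ?(ltW lam_gt0) //; field.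
  by rewrite !gt_eqF.
rewrite ler_pM2l ?mulr_gt0 // /rho lerDr divr_ge0 ?mulr_ge0 // ltW //.
Qed.

(** The factor 2 reflects that the row table has at most 2 n slots. *)
Lemma rowq_ge i : rowl2 A i <= 2 * F * rowq i.
Proof.
have F0 : F != 0 by rewrite gt_eqF.
have -> : 2 * F * rowq i = rowl2 A i * (2 * n%:R / rlen%:R).
  by rewrite /rowq; field; rewrite F0 pnatr_eq0 -lt0n rlen_gt0.
rewrite ler_peMr ?(ltW (rowl2_gt0 i)) // ler_pdivlMr ?ltr0n ?rlen_gt0 // mul1r.
exact: rlen_le.
Qed.

(** Values after the iteration are affine in the budget spent, at price [e1], and in the squared
    distance, at price [b]. Time is prepaid by the remaining budget at 60 steps per unit, with 70
    for the fixed overhead. *)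
Lemma iteration_ok K tau a0 b e1 m be si sp s : 0 <= tau -> 0 <= b -> 0 <= e1 ->
  0 <= a0 -> E0 <= e1 * Bud -> si != 0 -> 0 <= sp <= Bud ->
  (forall s' be' si' sp', dyn m be' si' sp' s' -> si' != 0 -> 0 <= sp' <= Bud ->
     ok phi (tau + 60 * (Bud - sp')) K s'
       (a0 + e1 * sp' + b * dotp (vec s' - vs) (vec s' - vs))) ->
  (forall s', framed s' -> nmem s' 22 0 0 = 0%N -> vec s' = 0 -> ok phi tau K s' E0) ->
  dyn m.+1 be si sp s ->
  ok phi (tau + 60 * (Bud - sp) + 70) (iteration :: K) s
    (a0 + e1 * (sp + rbar) + b * (dotp (vec s - vs) (vec s - vs)
       - eta * sqnorm B (vec s - vs) + eta / 8 * E0)).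
Proof.
move=> tau0 b0 e10 a00 hE si0 /andP[sp0 spB] hK habort ds.
have [fs hm [hbe hsi hsp]] := ds; have [fn fr] := fs.
set v := vec s.
pose y0 := (1 - eta * lam) *: v + eta *: (B *m vs) - vs.
pose rm i := row_moment A nsamples rowq v eta y0 i.
pose w1 i := a0 + e1 * (sp + rho i) + b * rm i.
pose w0 := a0 + e1 * sp + b * dotp y0 y0.
pose cnt (k : nat) : R := (nmem S 8 0 k)%:R.
pose p (i : 'I_n) := n%:R * rowl2 A i / (F * cnt i).
pose G (k : nat) := if insub k is Some i then p i * w1 i + (1 - p i) * w0 else 0.
have n0 : 0 < n%:R :> R by rewrite ltr0n n_gt0.
have wt_cnt (i : 'I_n) : n%:R * rowl2 A i / F <= cnt i.
  have := table_ge (post_table hS) (ltn_ord i).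
  by rewrite /row_wt input_pfrob input_pl2.
have cnt_gt0 (i : 'I_n) : 0 < cnt i.
  by apply: lt_le_trans (wt_cnt i); rewrite divr_gt0 ?mulr_gt0.
rewrite {1}/iteration; apply: ok_seq_le; apply: ok_straight_le => //.
set s1 := effect _ _.
have Es1 : s1 = nset s 22 0 0 (nmem s 22 0 0 - 1)%N by [].
rewrite hm subn1 /= in Es1; clearbody s1.
have fs1 : framed s1 by rewrite Es1; exact: framed_nset.
apply: ok_seq_le.
apply: (@ok_unif_le _ _ _ _ _ _ _ _ _ (fun u => G (nmem S 7 0 u)) _ rlen).
- by rewrite /=; lra.
- have h9 : nmem s1 9 0 0 = rlen by case: fs1 => fn1 _; rewrite fn1.
  by rewrite /= h9 subn1 prednK // rlen_gt0.
- move=> u hu; apply: ok_seq_le; apply: ok_straight_le => //.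
  have hiu : (nmem S 7 0 u < n)%N by apply: (table_lt (post_table hS)).
  set i : 'I_n := Ordinal hiu.
  set s2 := effect _ _.
  have Es2 : s2 = nset (nset s1 23 0 0 u) 20 0 0 (nmem s1 7 0 u) by [].
  have h7 : nmem s1 7 = nmem S 7 by case: fs1 => fn1 _; rewrite fn1.
  rewrite h7 -[nmem S 7 0 u]/(nat_of_ord i) in Es2; clearbody s2.
  have fs2 : framed s2 by rewrite Es2; do 2!apply: framed_nset => //.
  have hi2 : nmem s2 20 0 0 = i by rewrite Es2.
  have hm2 : nmem s2 22 0 0 = m by rewrite Es2 Es1.
  have -> : G (nmem S 7 0 u) = p i * w1 i + (1 - p i) * w0.
    by rewrite /G -[nmem S 7 0 u]/(val i) valK.
  apply: ok_seq_le.
  apply: (@ok_flip_le _ _ _ _ _ _ _ _ _ (p i) (w1 i) w0); last exact: lexx.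
  + have h8 : nmem s2 8 = nmem S 8 by case: fs2 => fn2 _; rewrite fn2.
    by rewrite /= hi2 h8 (mem_n fs2) (mem_l2 i fs2) (mem_frob fs2).
  + apply/andP; split; first by rewrite /p divr_ge0 ?mulr_ge0 // ltW.
    by rewrite /p invfM mulrA ler_pdivrMr // mul1r.
  + have Es3 : nset s2 24 (neval s2 (NConst 0)) (neval s2 (NConst 0)) 1 =
       nset s2 24 0 0 1 by [].
    rewrite Es3 {Es3}; set s3 := nset s2 24 0 0 1.
    have fs3 : framed s3 by exact: framed_nset.
    have hi3 : nmem s3 20 0 0 = i by rewrite /s3 -hi2.
    have ds3 : dyn m be si sp s3.
      by split=> //; rewrite /s3 Es2 Es1.
    have hv3 : vec s3 = v by rewrite /s3 Es2 Es1.
    apply: ok_if_le.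
    have -> : beval s3 (BNLt (nv 24) (NConst 1)) = false by [].
    apply: ok_if_le.
    have -> : beval s3 (BRLt (rv 12) (RAdd (rv 23) samples_needed)) =
        (Bud < sp + rho i).
      rewrite -(samples_neededE fs3 hi3) -[sp in RHS]hsp -[Bud]/(rmem S 12 0 0).
      by case: fs3 => _ fr3; rewrite -(fr3 12%N) // /s3 Es2 Es1.
    clearbody s3.
    have rm0 : 0 <= rm i.
      by apply: row_moment_ge0; [exact: nsamples_gt0].
    case: ltP => hbud.
      apply: ok_straight_le => //; set s4 := effect _ _.
      have Es4 : s4 = State (upd (nmem s3) 22 0 0 0%N)
         (upd (upd (rmem s3) 20 0 0 0) 21 0 0 0) by [].
      clearbody s4.
      have fs4 : framed s4.
        rewrite Es4; apply: (@framed_rset (State _ _) 21) => //.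
        apply: (@framed_rset (State _ _) 20) => //; exact: (@framed_nset s3 22).
      apply: ok_weaken (habort s4 fs4 _ _) _ _.
      * by rewrite Es4.
      * by rewrite vecE // Es4 /= /upd /= !scale0r addr0.
      * by rewrite /=; lra.
      (* On abort the charge exceeds [Bud], so its price alone covers the value E0 of returning
         x0. *)
      * apply: le_trans hE _; rewrite /w1.
        have : e1 * Bud <= e1 * (sp + rho i) by rewrite ler_wpM2l // ltW.
        have : 0 <= b * rm i by rewrite mulr_ge0.
        lra.
    have dec0 : 1 - eta * lam != 0 by rewrite subr_eq0 gt_eqF.
    have tau1 : 0 <= tau + 60 * (Bud - (sp + rho i)) by lra.
    apply: ok_weaken (@row_update_ok i K (tau + 60 * (Bud - (sp + rho i)))
       (a0 + e1 * (sp + rho i)) b m be si sp s3 tau1 b0 si0 _ ds3 hi3) _ _.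
    * move=> s' ds'; apply: hK ds' _ _; first by rewrite mulf_neq0.
      by rewrite hbud addr_ge0 ?rho_ge0.
    * have := nceil_le (rho_ge0 i); rewrite -/(nsamples i).
      by have := rho_ge0 i; rewrite /=; lra.
    * by rewrite hv3 lexx.
  + have Es3 : nset s2 24 (neval s2 (NConst 0)) (neval s2 (NConst 0)) 0 =
       nset s2 24 0 0 0 by [].
    rewrite Es3 {Es3}; set s3 := nset s2 24 0 0 0.
    have fs3 : framed s3 by exact: framed_nset.
    apply: ok_if_le.
    have -> : beval s3 (BNLt (nv 24) (NConst 1)) = true by [].
    apply: ok_straight_le => //; set s4 := effect _ _.
    have Es4 : s4 = State (nmem s3)
     (upd (upd (rmem s3) 20 0 0 ((1 - rmem s3 11 0 0 * rmem s3 0 0 0) *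
          rmem s3 20 0 0 - rmem s3 11 0 0))
        21 0 0 ((1 - rmem s3 11 0 0 * rmem s3 0 0 0) * rmem s3 21 0 0)) by [].
    rewrite (mem_eta fs3) (mem_lam fs3) in Es4; clearbody s4.
    have r3 : rmem s3 = rmem s by rewrite /s3 Es2 Es1.
    have fs4 : framed s4.
      rewrite Es4; apply: (@framed_rset (State _ _) 21) => //.
      exact: (@framed_rset s3 20).
    have ds4 : dyn m ((1 - eta * lam) * be - eta) ((1 - eta * lam) * si) sp s4.
      by split; rewrite // Es4 // r3 /= /upd /= hbe hsi.
    have hv4 : vec s4 = (1 - eta * lam) *: v + eta *: (B *m vs).
      by apply: decay_vec => //; rewrite Es4 r3.
    apply: ok_weaken (hK _ _ _ _ ds4 _ _) _ _.
    * by rewrite mulf_neq0 // subr_eq0 gt_eqF.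
    * by rewrite sp0 spB.
    * by rewrite /=; lra.
    * by rewrite hv4 lexx.
rewrite (table_sum (post_table hS) G).
have rl0 : rlen%:R != 0 :> R by rewrite pnatr_eq0 -lt0n rlen_gt0.
have F0 : F != 0 by rewrite gt_eqF.
have sum_cnt : \sum_(i < n) cnt i = rlen%:R.
  have := table_sum (post_table hS) (fun=> 1); rewrite sum_const mulr1 -/rlen => ->.
  by apply: eq_bigr => k _; rewrite mulr1.
(* The slot count cancels against the acceptance probability, leaving [rowq i]. *)
have -> : rlen%:R^-1 * (\sum_(k < n) (nmem S 8 0 k)%:R * G k) =
    w0 + \sum_i rowq i * (w1 i - w0).
  transitivity (rlen%:R^-1 * \sum_(i < n) (cnt i * w0 + n%:R * rowl2 A i / F * (w1 i - w0))).
    congr (_ * _); apply: eq_bigr => i _; rewrite /G valK -/(cnt i) /p.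
    have cn0 : cnt i != 0 by rewrite gt_eqF.
    by field; rewrite ?F0 ?cn0.
  rewrite big_split /= -mulr_suml sum_cnt mulrDr mulKf // mulr_sumr.
  congr (_ + _); apply: eq_bigr => i _; rewrite /rowq; field.
  by rewrite ?F0 ?rl0.
have -> : \sum_i rowq i * (w1 i - w0) = e1 * (\sum_i rowq i * rho i) +
    b * (\sum_i rowq i * rm i - (\sum_i rowq i) * dotp y0 y0).
  rewrite mulrBr !mulr_sumr mulr_suml mulr_sumr -sumrB -big_split /=.
  by apply: eq_bigr => i _; rewrite /w1 /w0; ring.
have h1 := @sum_row_moment_le R n d A lam1 lam g gram_le lam1_gt0 lam1_le
  nsamples rowq v nsamples_gt0 nsamples_sparse nsamples_frob rowq_gt0
  rowq_ge frob2_gt0 vs eta g_gt0 erefl mu_ge frob_lam y0 erefl.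
have h2 : e1 * (\sum_i rowq i * rho i) <= e1 * rbar.
  by rewrite ler_wpM2l // sum_rowq_rho.
have h3 := ler_wpM2l b0 h1.
rewrite /w0; move: h3; rewrite -/E0 -/B.
set T1 := \sum_i _; set T2 := \sum_i rowq i.
have -> : b * (T1 + (1 - T2) * dotp y0 y0) =
   b * dotp y0 y0 + b * (T1 - T2 * dotp y0 y0) by ring.
by lra.
Qed.

(** The three terms pay for the distance to x*, for the noise from x0, and for the risk of abort,
    which is priced at E0 per full budget. *)
Definition potential (m : nat) (sp : R) (v : 'cV[R]_d) : R :=
  if m is 0 then sqnorm B (v - vs)
  else dotp (v - vs) (v - vs) / (m%:R * eta) + E0 / 8
       + E0 / Bud * (sp + m%:R * rbar).

Lemma rbar_ge0 : 0 <= rbar.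
Proof.
rewrite divr_ge0 ?(ltW frob2_gt0) // sumr_ge0 // => i _.
by rewrite mulr_ge0 ?rho_ge0 // ltW.
Qed.

(** Stopping has probability 1 / (m + 1) and costs the B-norm; continuing has probability m / (m +
    1) and lowers |v - vs|^2 / (m eta) by the B-norm divided by m. The two occurrences of the B-norm
    cancel, and the remaining terms telescope. *)
Lemma main_loop m : forall be si sp s, dyn m be si sp s -> si != 0 ->
  0 <= sp <= Bud ->
  ok phi (80 * m%:R + 60 * (Bud - sp) + 10)
    [:: While (BNLt (NConst 0) (nv 22)) main_body] s (potential m sp (vec s)).
Proof.
have exit_ok tau s v : framed s -> nmem s 22 0 0 = 0%N -> 1 <= tau ->
    sqnorm B (vec s - vs) <= v ->
    ok phi tau [:: While (BNLt (NConst 0) (nv 22)) main_body] s v.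
  move=> fs hm htau hv; apply: ok_while_le; rewrite [beval _ _]/= hm.
  by apply: ok_nil; rewrite ?phiE // subr_ge0.
elim: m => [|m IH] be si sp s ds si0 hsp; have [fs hm [hbe hsi hsps]] := ds.
  by apply: exit_ok => //; case/andP: hsp => _; lra.
have /andP[sp0 spB] := hsp.
have e10 : 0 <= E0 / Bud by rewrite divr_ge0 ?E0_ge0 // ltW.
apply: ok_while_le; rewrite [beval _ _]/= hm /=.
rewrite {1}/main_body; apply: ok_seq_le.
set v := vec s.
have m0 : 0 <= m%:R :> R by [].
pose V := (E0 / 8 + E0 / Bud * (m%:R * rbar)) + E0 / Bud * (sp + rbar) +
  (m%:R * eta)^-1 * (dotp (v - vs) (v - vs) - eta * sqnorm B (v - vs) + eta / 8 * E0).
apply: (@ok_unif_le _ _ _ _ _ _ _ _ _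
  (fun x => if x == 0%N then sqnorm B (v - vs) else V) _ m.+1).
- by rewrite -[m.+1%:R]natr1; lra.
- by rewrite /= hm subn1.
- move=> x hx.
  set s1 := nset _ _ _ _ _.
  have Es1 : s1 = nset s 23 0 0 x by [].
  clearbody s1.
  have fs1 : framed s1 by rewrite Es1; exact: framed_nset.
  have hv1 : vec s1 = v by rewrite Es1.
  have ds1 : dyn m.+1 be si sp s1 by split=> //; rewrite Es1.
  apply: ok_if_le.
  have -> : beval s1 (BNLt (nv 23) (NConst 1)) = (x == 0%N).
    by rewrite Es1 /= ltnS leqn0.
  case: (posnP x) => [_|x_gt0].
    apply: ok_straight_le => //; set s2 := effect _ _.
    have Es2 : s2 = nset s1 22 0 0 0%N by [].
    clearbody s2.
    have fs2 : framed s2 by rewrite Es2; exact: framed_nset.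
    apply: exit_ok => //; first by rewrite Es2.
      by rewrite -[m.+1%:R]natr1 /=; lra.
    by rewrite -hv1 Es2 lexx.
  case: m IH hx hm ds m0 @V ds1 => [|m'] IH hx hm ds m0 V ds1.
    by move: hx; rewrite ltnS leqNgt x_gt0.
  set m := m'.+1 in IH hx hm ds m0 V ds1 *.
  have mp : 0 < m%:R :> R by rewrite ltr0n.
  have b0 : 0 <= (m%:R * eta)^-1 by rewrite invr_ge0 mulr_ge0 // ltW.
  have a00 : 0 <= E0 / 8 + E0 / Bud * (m%:R * rbar).
    by rewrite addr_ge0 ?divr_ge0 ?E0_ge0 // mulr_ge0 // mulr_ge0 // rbar_ge0.
  have hE : E0 <= E0 / Bud * Bud by rewrite divfK ?gt_eqF.
  have tau0 : 0 <= 80 * m%:R + 10 :> R by lra.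
  apply: ok_weaken (@iteration_ok _ (80 * m%:R + 10)
     (E0 / 8 + E0 / Bud * (m%:R * rbar)) (m%:R * eta)^-1 (E0 / Bud) m be si sp s1
     tau0 b0 e10 a00 hE si0 hsp _ _ ds1) _ _.
  + move=> s' be' si' sp' ds' si'0 hsp'.
    apply: ok_weaken (IH _ _ _ _ ds' si'0 hsp') _ _; first by lra.
    rewrite /potential /m -/m [X in _ <= X]addrC mulrC.
    by rewrite [_^-1 * dotp _ _]mulrC -/m; lra.
  + move=> s' fs' hm' hv'; apply: exit_ok => //; first by lra.
    rewrite hv' sub0r /E0 !(sqnormBE A lam) mulmxN !dotpNl !dotpNr !opprK.
    exact: lexx.
  + by rewrite -[m.+1%:R]natr1; lra.
  + by rewrite hv1 lexx.
- rewrite big_ord_recl /= (eq_bigr (fun=> V)) // sum_const.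
  have m1 : 0 < m.+1%:R :> R by rewrite ltr0n.
  rewrite mulrC ler_pdivrMr // -/v.
  have mE : m.+1%:R = m%:R + 1 :> R by rewrite natr1.
  (* The indicator is m times the inverse of m, which is 0 at m = 0. *)
  have -> : m%:R * V = m%:R * (E0 / 8 + E0 / Bud * (sp + m.+1%:R * rbar)) +
     (m != 0%N)%:R * (dotp (v - vs) (v - vs) / eta - sqnorm B (v - vs) + E0 / 8).
    rewrite /V mE; case: (posnP m) => [->|mp]; first by rewrite /= !mul0r addr0.
    rewrite /= mul1r; field.
    by rewrite !gt_eqF // ltr0n.
  have -> : (dotp (v - vs) (v - vs) / (m.+1%:R * eta) + E0 / 8 +
     E0 / Bud * (sp + m.+1%:R * rbar)) * m.+1%:R =
     dotp (v - vs) (v - vs) / eta +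
     (m%:R + 1) * (E0 / 8 + E0 / Bud * (sp + m.+1%:R * rbar)).
    rewrite -mE; move: (m.+1%:R) m1 => M M0; field.
    by rewrite ?(gt_eqF M0) ?(gt_eqF eta_gt0) ?(gt_eqF Bud_gt0).
  have h1 : 0 <= E0 / Bud * (sp + m.+1%:R * rbar).
    by rewrite mulr_ge0 // addr_ge0 // mulr_ge0 // rbar_ge0.
  move: h1; case: (posnP m) => [->|mp] /= h1.
    rewrite !mul0r !addr0 add0r mul1r.
    (* The last iteration stops for certain, so the distance term must cover the B-norm; this uses
       eta lam < 1. *)
    have hB : eta * sqnorm B (v - vs) <= dotp (v - vs) (v - vs).
      rewrite sqnormBE.
      have h2 := dotp_ge0 (A *m (v - vs)); have h3 := dotp_ge0 (v - vs).
      have h4 : eta * lam * dotp (v - vs) (v - vs) <= dotp (v - vs) (v - vs).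
        by rewrite ler_piMl // ltW.
      have h5 : 0 <= eta * dotp (A *m (v - vs)) (A *m (v - vs)).
        by rewrite mulr_ge0 // ltW.
      lra.
    have : sqnorm B (v - vs) <= dotp (v - vs) (v - vs) / eta.
      by rewrite ler_pdivlMr // mulrC.
    by have := E0_ge0; lra.
  move: h1; set h := E0 / Bud * _; set D := dotp _ _ / eta; set Q := sqnorm B _.
  rewrite mul1r => h1; clearbody h D Q; move: (m%:R : R) => M.
  have -> : Q + (M * (E0 / 8 + h) + (D - Q + E0 / 8)) =
    D + (M + 1) * (E0 / 8 + h) - h by ring.
  by rewrite lerBlDr lerDl.
Qed.

(** The initial potential is at most E0 / 8 for the distance, E0 / 8 for the noise and E0 / 4 for
    the abort, the last because the budget is four times the expected charge. *)
Lemma main_loop_init :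
  Bud = 4 * (nmem S 22 0 0)%:R * rbar -> (0 < nmem S 22 0 0)%N -> 0 < rbar ->
  100 * 100 * 100 * 100 * F <= (nmem S 22 0 0)%:R * (lam * (g * g)) ->
  ok phi (80 * (nmem S 22 0 0)%:R + 60 * Bud + 10)
    [:: While (BNLt (NConst 0) (nv 22)) main_body] S (2^-1 * E0).
Proof.
set m := nmem S 22 0 0 => EBud m_gt0 rbar_gt0 hm.
have fS : framed S by [].
have dS : dyn m 0 1 0 S.
  by split=> //; rewrite (post_beta hS) (post_sigma hS) (post_spent hS).
have sp0 : 0 <= (0 : R) <= Bud by rewrite lexx ltW.
apply: ok_weaken (main_loop dS (oner_neq0 _) sp0) _ _; first by rewrite subr0.
have -> : vec S = 0.
  rewrite vecE // (post_beta hS) scale0r add0r.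
  have -> : wvec S = 0 by apply/matrixP => j z; rewrite !mxE (pre_w hrows).
  by rewrite scaler0.
have mp : 0 < m%:R :> R by rewrite ltr0n.
rewrite /potential -(prednK m_gt0) (prednK m_gt0) sub0r dotpNl dotpNr opprK add0r.
have h1 : E0 / Bud * (m%:R * rbar) = E0 / 4.
  by rewrite EBud; field; rewrite !gt_eqF.
have mu_gt0 : 0 < lam * g / 152 by rewrite divr_gt0 // mulr_gt0.
have hs : lam * g / 152 * dotp vs vs <= E0.
  apply: le_trans (sqnormB_ge lam gram_le vs).
  by rewrite ler_wpM2r ?dotp_ge0.
have h2 : dotp vs vs / (m%:R * eta) <= E0 / 8.
  have -> : dotp vs vs / (m%:R * eta) =
     (100 * 100 * 5 * F * 152) / (m%:R * (lam * (g * g))) * (lam * g / 152 * dotp vs vs).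
    by rewrite /eta; field; rewrite !gt_eqF.
  (* Here 50000 * 152 is at most an eighth of 10^8, the constant in the number of iterations. *)
  apply: (@le_trans _ _ (8^-1 * (lam * g / 152 * dotp vs vs))).
    apply: ler_wpM2r; first by rewrite mulr_ge0 ?dotp_ge0 // ltW.
    rewrite ler_pdivrMr ?mulr_gt0 //.
    have := frob2_gt0; lra.
  lra.
rewrite h1; lra.
Qed.

End Main.

(** * Running time and error *)

Section Solver.
Variables (R : realType) (n d : nat) (A : 'M[R]_(n, d)).
Variables (lam1 lam g : R) (c x0 xs : 'cV[R]_d).
Let s0 := input A lam g c x0.
Let B := lam%:M - A^T *m A.
Let F := frob2 A.
Hypothesis Bxs : B *m xs = c.
Hypothesis rowl1_gt0 : forall i, 0 < rowl1 A i.
Hypothesis rowl2_gt0 : forall i, 0 < rowl2 A i.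
Hypothesis gram_le : forall x, dotp (A *m x) (A *m x) <= lam1 * dotp x x.
Hypotheses (frob2_gt0 : 0 < F) (lam1_gt0 : 0 < lam1) (lam1_le : lam1 <= lam).
Hypotheses (g_gt0 : 0 < g) (mu_ge : lam * g / 152 <= lam - lam1).
Hypothesis g_le1 : g <= 1.
Hypothesis lam_le : lam <= 2 * F.

Let lam_gt0 : 0 < lam. Proof. exact: lt_le_trans lam1_le. Qed.

Lemma rowl2_le_l1 i : rowl2 A i <= rowl1 A i ^+ 2.
Proof.
rewrite expr2 {1}/rowl1 mulr_suml; apply: ler_sum => j _.
rewrite -real_normK ?num_real // expr2 ler_wpM2l // /rowl1 (bigD1 j) //= lerDl.
exact: sumr_ge0.
Qed.

Lemma rho_ge1 i : 1 <= rho A lam i.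
Proof.
apply: (@le_trans _ _ (rowl1 A i * rowl1 A i / rowl2 A i)).
  by rewrite ler_pdivlMr // mul1r -expr2 rowl2_le_l1.
by rewrite lerDl mulr_ge0 ?sqrtr_ge0 // divr_ge0 ?sqrtr_ge0 // ltW.
Qed.

(** The form accumulated in preprocessing: sqrt (F / lam) is factored out because F is known only
    after the last row. *)
Lemma rowl2_rho i : rowl2 A i * rho A lam i =
  rowl1 A i ^+ 2 + Num.sqrt (F / lam) * (rowl1 A i * Num.sqrt (rowl2 A i)).
Proof.
have l20 : rowl2 A i != 0 by rewrite gt_eqF.
have s0' : Num.sqrt (rowl2 A i) != 0 by rewrite gt_eqF // sqrtr_gt0.
rewrite /rho mulrDr; congr (_ + _); first by field.
have {1}-> : rowl2 A i = Num.sqrt (rowl2 A i) ^+ 2 by rewrite sqr_sqrtr // ltW.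
by rewrite -/F; field.
Qed.

Lemma input_prho_sum : prho_sum s0 = \sum_i rowl2 A i * rho A lam i.
Proof.
rewrite /prho_sum input_pfrob mulr_sumr -big_split /=.
by apply: eq_bigr => i _; rewrite input_pl1 input_pl2 rowl2_rho.
Qed.

Let M := \sum_i rowl2 A i * rho A lam i.
Let T := nceil (piters s0).

(** As every [rho] is at least 1, the number of iterations is absorbed in the number of samples. *)
Lemma frob_le_M : F <= M.
Proof. by apply: ler_sum => i _; rewrite ler_peMr ?rho_ge1 // ltW. Qed.

Lemma pitersE : piters s0 = 100 * 100 * 100 * 100 * F / (lam * (g * g)).
Proof. by rewrite /piters input_pfrob. Qed.

Lemma piters_gt0 : 0 < piters s0.
Proof. by rewrite pitersE divr_gt0 // !mulr_gt0. Qed.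

(** The 1 lost in the ceiling is at most 2 F / (lam g^2), since g <= 1 and lam <= 2 F. *)
Lemma T_le : T%:R <= (100 * 100 * 100 * 100 + 2) * (F / (lam * (g * g))).
Proof.
apply: le_trans (nceil_le (ltW piters_gt0)) _; rewrite pitersE.
have -> : (100 * 100 * 100 * 100 + 2) * (F / (lam * (g * g))) =
  100 * 100 * 100 * 100 * F / (lam * (g * g)) + 2 * F / (lam * (g * g)) by ring.
rewrite lerD2l ler_pdivlMr ?mulr_gt0 // mul1r; apply: le_trans lam_le.
by rewrite ler_piMr ?(ltW lam_gt0) // mulr_ile1 // ltW.
Qed.

(** The coefficient 240 is 60 steps per unit of a budget of 4 T M / F; 82 is 80 for the main loop
    and 2 for counting the iterations. *)
Lemma solver_ok : ok (fun s => sqnorm B (output solver d s - xs))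
  (1 + 100 * ((nnz A)%:R + n%:R + 1) + 82 * T%:R + 240 * T%:R * (M / F) + 10)
  [:: body solver] s0 (2^-1 * sqnorm B (xs - x0)).
Proof.
have T_gt0 : (0 < T)%N.
  by rewrite -(ltr0n R); apply: lt_le_trans piters_gt0 (ler_nceil (ltW piters_gt0)).
have rbar_gt0 : 0 < rbar A lam.
  by rewrite /rbar divr_gt0 // -/M; apply: lt_le_trans frob_le_M.
have EBud : 4 * T%:R * prho_sum s0 / pfrob s0 = 4 * T%:R * rbar A lam.
  by rewrite input_pfrob input_prho_sum /rbar -mulrA.
apply: (@ok_weaken _ _ ((80 * T%:R + 60 * (4 * T%:R * rbar A lam) + 10) +
    (100 * (\sum_(i < nmem s0 0 0 0) (nmem s0 1 i 0)%:R + (nmem s0 0 0 0)%:R + 1)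
     + 2 * T%:R) + 1) _ _ _ (2^-1 * sqnorm B (xs - x0))) => //; last first.
  rewrite -natr_sum [X in X%:R + _ + _]sum_input_nnz -[nmem s0 0 0 0]/n /rbar -/M -/F.
  by lra.
apply: ok_seq.
apply: (@preprocess_spec _ _ s0) (input_rows_inv _ _ _ _ _) _ => //.
- move=> i hi; rewrite -[i]/(val (Ordinal (hi : (i < n)%N))) input_pl1.
  exact: rowl1_gt0.
- by rewrite input_pfrob.
move=> S hS.
have ET : nmem S 22 0 0 = T := post_iters hS.
have EB : rmem S 12 0 0 = 4 * T%:R * rbar A lam by rewrite (post_budget hS) -EBud.
have Tp : 0 < T%:R :> R by rewrite ltr0n.
have lamg : lam * g <= 2 * F.
  by apply: le_trans lam_le; rewrite ler_piMr // ltW.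
have := @main_loop_init R n d A lam1 lam g c x0 xs Bxs rowl1_gt0 rowl2_gt0
  frob2_gt0 lam_gt0 S hS; rewrite EB ET; apply => //.
- have -> : g / (100 * 100 * 5 * frob2 A) * lam = lam * g / (100 * 100 * 5 * F).
    by rewrite -/F; ring.
  rewrite ltr_pdivrMr ?mulr_gt0 // mul1r; apply: le_lt_trans lamg _.
  by rewrite ltr_pM2r //; lra.
- by rewrite divr_gt0 // !mulr_gt0.
- by apply: mulr_gt0 => //; apply: mulr_gt0.
- have := ler_nceil (ltW piters_gt0); rewrite -/T pitersE.
  by rewrite ler_pdivrMr // !mulr_gt0.
Qed.

End Solver.

Theorem theorem8 (R : realType) :
  exists (P : program) (C : R), 0 < C /\
  forall (n d : nat) (A : 'M[R]_(n, d)) (lam1 lam2 : R) (lams : seq R)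
         (lam : R) (c xstar : 'cV[R]_d),
    let gap := (lam1 - lam2) / lam1 in
    let B := lam%:M - A^T *m A in
    (forall i, row i A != 0) ->
    eigenvalues_desc (A^T *m A) [:: lam1, lam2 & lams] ->
    0 < gap ->
    lam1 * (1 + gap / 150%:R) <= lam <= lam1 * (1 + gap / 100%:R) ->
    is_argmin (quad_obj B c) xstar ->
    forall x0 : 'cV[R]_d,
      let s0 := input A lam gap c x0 in
      exists t : nat,
        [/\ t%:R <= C * ((nnz A)%:R + (gap ^+ 2 * lam1)^-1 *
                         \sum_(i < n) l2norm (row i A) ^+ 2 *
                           (Num.sqrt (numsparsity A i)
                            + Num.sqrt (stable_rank A))
                           * Num.sqrt (numsparsity A i)),
            halts_within P s0 t
          & expected_output P s0 t (fun x => sqnorm B (x - xstar))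
              <= 2^-1 * sqnorm B (x0 - xstar)].
Proof.
(* The constant of [T_le]. The factor 400 below exceeds 311 and 322, the coefficients of nnz and K X
   in the final estimate. *)
pose K : R := 100 * 100 * 100 * 100 + 2.
have K1 : 1 <= K by rewrite /K; lra.
exists solver, (400 * K); split; first by rewrite mulr_gt0 //; lra.
move=> n d A lam1 lam2 lams lam c xs g B row_neq0 eigs g_gt0 /andP[lam_ge lam_le] amin x0 s0.
have lam1_ge0 : 0 <= lam1 by apply: (eigs_ge0 eigs); rewrite mem_head.
have lam2_ge0 : 0 <= lam2 by apply: (eigs_ge0 eigs); rewrite !inE eqxx orbT.
have lam1_gt0 : 0 < lam1.
  rewrite lt_neqAle lam1_ge0 andbT; apply: contraTneq g_gt0 => E.
  by rewrite /g -E invr0 mulr0 ltxx.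
have g_le1 : g <= 1 by rewrite /g ler_pdivrMr // mul1r; lra.
clearbody g.
have gram_le := gram_le_lam1 eigs.
have lg : lam1 * g <= lam1 by rewrite ler_piMr.
have lg0 : 0 < lam1 * g by rewrite mulr_gt0.
have lam1_le : lam1 <= lam by lra.
have lam_gt0 : 0 < lam by exact: lt_le_trans lam1_le.
have lam_le2 : lam * 100 <= 101 * lam1 by lra.
(* As lam <= 1.01 lam1, the lower bound lam1 g / 150 is at least lam g / 151.5. *)
have mu_ge : lam * g / 152 <= lam - lam1.
  have : lam * g * 100 <= 101 * (lam1 * g).
    by rewrite mulrAC mulrA ler_pM2r.
  lra.
have nonzero i : exists j, A i j != 0.
  apply/existsP; apply: contraNT (row_neq0 i); rewrite negb_exists => /forallP h.
  by apply/eqP/rowP => j; rewrite !mxE; apply/eqP; have := h j; rewrite negbK.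
have rowl1_gt0 i : 0 < rowl1 A i.
  have [j hj] := nonzero i; rewrite /rowl1 (bigD1 j) //= ltr_pwDl ?normr_gt0 //.
  exact: sumr_ge0.
have rowl2_gt0 i : 0 < rowl2 A i.
  have [j hj] := nonzero i; rewrite /rowl2 (bigD1 j) //= ltr_pwDl //.
    by rewrite exprn_even_gt0.
  by apply: sumr_ge0 => k _; exact: sqr_ge0.
set F := frob2 A.
have lam1_F : lam1 <= F := lam1_le_frob eigs.
have F_gt0 : 0 < F by exact: lt_le_trans lam1_F.
have lam_2F : lam <= 2 * F by lra.
have Bxs : B *m xs = c.
  by apply: argmin_solves amin; rewrite linearB /= tr_scalar_mx trmx_mul trmxK.
have n_gt0 : (0 < n)%N.
  rewrite lt0n; apply/eqP => n0; move: F_gt0; rewrite /F /frob2.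
  by rewrite big1 ?ltxx // => i; have := ltn_ord i; rewrite {2}n0.
have [t [ht hhalt hexp]] := solver_ok x0 Bxs rowl1_gt0 rowl2_gt0 gram_le F_gt0
  lam1_gt0 lam1_le g_gt0 mu_ge g_le1 lam_2F.
exists t; split => //; last first.
  apply: le_trans hexp _; rewrite !(sqnormBE A lam) -[xs - x0]opprB.
  by rewrite mulmxN !dotpNl !dotpNr !opprK lexx.
apply: le_trans ht _.
set X := (g ^+ 2 * lam1)^-1 * _.
set M := \sum_i rowl2 A i * rho A lam i.
(* The program knows lam but neither lam1 nor sr(A); both lam1 <= lam and F / lam <= sr(A) go in the
   favourable direction. *)
have hX : M / (lam * (g * g)) <= X.
  have sn0 : 0 < specnorm A.
    have [j hj] := nonzero (Ordinal n_gt0); exact: specnorm_gt0 hj.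
  have sn1 : specnorm A ^+ 2 <= lam.
    by apply: le_trans lam1_le; apply: specnorm_le.
  have hsr : F / lam <= stable_rank A.
    rewrite /stable_rank /frobnorm sqr_sqrtr -/F; last exact: ltW.
    by rewrite ler_pM2l // lef_pV2 // posrE // exprn_gt0.
  have hM : M <= \sum_(i < n) l2norm (row i A) ^+ 2 * (Num.sqrt (numsparsity A i)
       + Num.sqrt (stable_rank A)) * Num.sqrt (numsparsity A i).
    apply: ler_sum => i _.
    have El2 : l2norm (row i A) ^+ 2 = rowl2 A i.
      rewrite /l2norm sqr_sqrt_sum; apply: eq_bigr => j _; by rewrite mxE.
    have El1 : l1norm (row i A) = rowl1 A i.
      by apply: eq_bigr => j _; rewrite mxE.
    rewrite El2 -mulrA ler_pM2l // /numsparsity El1 El2.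
    have s2 : 0 < Num.sqrt (rowl2 A i) by rewrite sqrtr_gt0.
    have -> : Num.sqrt (rowl1 A i ^+ 2 / rowl2 A i) = rowl1 A i / Num.sqrt (rowl2 A i).
      rewrite sqrtrM ?sqr_ge0 // sqrtr_sqr sqrtrV ?(ltW (rowl2_gt0 i)) //.
      by rewrite ger0_norm // ltW.
    have -> : rho A lam i = rowl1 A i / Num.sqrt (rowl2 A i) *
       (rowl1 A i / Num.sqrt (rowl2 A i)) +
       Num.sqrt (F / lam) * (rowl1 A i / Num.sqrt (rowl2 A i)).
      rewrite /rho [_ * Num.sqrt (F / lam)]mulrC; congr (_ + _).
      rewrite -{1}(@sqr_sqrtr _ (rowl2 A i)) ?(ltW (rowl2_gt0 i)) //; field.
      by rewrite gt_eqF.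
    rewrite [leRHS]mulrDl lerD2l ler_wpM2r //.
      by rewrite divr_ge0 // ltW.
    rewrite ler_sqrt // (le_trans _ hsr) // divr_ge0 // ltW //.
  rewrite /X [leRHS]mulrC; apply: ler_pM => //.
  - by apply: sumr_ge0 => i _; rewrite mulr_ge0 ?rho_ge0 // ltW.
  - by rewrite invr_ge0 !mulr_ge0 // ltW.
  - rewrite lef_pV2 ?posrE ?mulr_gt0 ?exprn_gt0 // expr2 mulrC.
    by rewrite ler_wpM2r // mulr_ge0 // ltW.
set T : R := (nceil _)%:R.
have hT : T <= K * (F / (lam * (g * g))).
  exact: T_le F_gt0 lam1_gt0 lam1_le g_gt0 g_le1 lam_2F.
have MF : F <= M by apply: frob_le_M.
have lgg : 0 < lam * (g * g) by rewrite !mulr_gt0.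
have hT1 : T <= K * X.
  apply: le_trans hT _; rewrite ler_wpM2l //; first lra.
  by apply: le_trans hX; rewrite ler_pM2r ?invr_gt0.
have hT2 : T * (M / F) <= K * X.
  apply: (@le_trans _ _ (K * (F / (lam * (g * g))) * (M / F))).
    by rewrite ler_wpM2r // divr_ge0 ?(ltW F_gt0) // (le_trans (ltW F_gt0)).
  have -> : K * (F / (lam * (g * g))) * (M / F) = K * (M / (lam * (g * g))).
    by field; rewrite !gt_eqF.
  by rewrite ler_wpM2l //; lra.
(* Every row has a nonzero entry, so the overhead per row is within nnz. *)
have n_nnz : n%:R <= (nnz A)%:R :> R.
  rewrite ler_nat -(sum_input_nnz A lam g c x0) -[leqLHS]card_ord -sum1_card.
  by apply: leq_sum => i _; apply: row_nnz_gt0.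
have n1 : 1 <= n%:R :> R by rewrite ler1n.
have X0 : 0 <= X.
  apply: le_trans hX; apply: divr_ge0; last exact: ltW.
  exact: le_trans (ltW F_gt0) MF.
have : (nnz A)%:R <= K * (nnz A)%:R by rewrite ler_peMl.
rewrite -/F -/M -/T [400 * K * _]mulrDr -!mulrA.
have KX0 : 0 <= K * X by rewrite mulr_ge0 //; lra.
lra.
Qed.
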